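(* Let $\mathrm{DM}$ be a decomposition method, let $\mathbb{A}$ be a connected left-hand structure, and let $O=\{X_1,\dots,X_m\}\subseteq A$, $m\ge1$, be a set of variables. If $(\mathbb{A},O)$ is tp-covered through $\mathrm{DM}$, then the algorithm $\mathtt{ComputeAllSolutions}_{\mathrm{DM}}$ runs with polynomial delay (WPD) on the inputs $(\mathbb{A},\mathbb{B},O)$, for every right-hand structure $\mathbb{B}$ (where the polynomial bounding the delay depends only on $\mathrm{DM}$).
   Context: **Structures and homomorphisms.** All structures are finite. A relational structure $\mathbb{A}$ over a finite vocabulary $\tau$ has a universe $A$ (whose elements are called variables when $\mathbb{A}$ is the left-hand structure) and a relation $R^{\mathbb{A}}\subseteq A^r$ for each $r$-ary $R\in\tau$. A CSP instance is a pair $(\mathbb{A},\mathbb{B})$ of structures over the same vocabulary ($\mathbb{A}$ left-hand, $\mathbb{B}$ right-hand). $\mathbb{A}^{\mathbb{B}}$ is the set of homomorphisms from $\mathbb{A}$ to $\mathbb{B}$, and $\mathbb{A}^{\mathbb{B}}[X]$ the set of their restrictions to $X\subseteq A$. An ECSP instance is a triple $(\mathbb{A},\mathbb{B},O)$ with $O\subseteq A$; the task is to compute $\mathbb{A}^{\mathbb{B}}[O]$, whose elements are called the solutions of the instance. $\mathbb{A}\uplus\mathbb{A}'$ (disjoint vocabularies) is the structure whose vocabulary, universe and relations are the unions of those of $\mathbb{A}$ and $\mathbb{A}'$. $\mathbb{A}'$ is a substructure of $\mathbb{A}$ if $A'\subseteq A$ and $R^{\mathbb{A}'}\subseteq R^{\mathbb{A}}$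 for every $R$ (not necessarily induced). $\mathbb{A}'$ is a core of $\mathbb{A}$ if it is a substructure of $\mathbb{A}$ such that there is a homomorphism from $\mathbb{A}$ to $\mathbb{A}'$ and no substructure of $\mathbb{A}'$ other than $\mathbb{A}'$ has this property. **Polynomial delay (WPD).** An algorithm solves a computation problem WPD if there is a polynomial $p$ such that, for every instance of size $n$, it discovers within time $O(p(n))$ if there are no solutions; otherwise it outputs all solutions in such a way that each new solution is computed within $O(p(n))$ time from the previous one (the first within $O(p(n))$ time from the start). **Hypergraphs and tree projections.** $\mathcal{H}_{\mathbb{A}}$ is the hypergraph with node set $A$ and, for each tuple in each relation of $\mathbb{A}$, a hyperedge consisting of the variables in the tuple. $\mathbb{A}$ is connected if $\mathcal{H}_{\mathbb{A}}$ is. A hypergraph is acyclic if it has a join tree: a tree whose vertices are its hyperedges such that, whenever a node $X$ occurs in two hyperedges, $X$ occurs in every vertex on the path linking them. $\mathcal{H}_1\le\mathcal{H}_2$ means every hyperedge of $\mathcal{H}_1$ is contained in some hyperedge of $\mathcal{H}_2$. A tree projection of $(\mathcal{H}_1,\mathcal{H}_2)$ is an acyclic hypergraph $\mathcal{H}_a$ with $\mathcal{H}_1\le\mathcal{H}_a\le\mathcal{H}_2$. **Views and decomposition methods.** A view structure for $\mathbb{A}$ is a structure $\mathbb{A}_{\mathcal V}$ with universe $A$ over a vocabulary $\tau_{\mathcal V}$ disjoint from $\tau$, in which every relation contains a single tuple (whose set of variables is denoted $\mathrm{var}(R^{\mathbb{A}_{\mathcal V}})$), and such that for every $R\in\tau$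 and $t\in R^{\mathbb{A}}$ there is a symbol $R_t\in\tau_{\mathcal V}$, called a base view, with $R_t^{\mathbb{A}_{\mathcal V}}=\{t\}$. A structure $\mathbb{B}_{\mathcal V}$ over $\tau_{\mathcal V}$ is legal w.r.t. $\mathbb{A}_{\mathcal V}$ and $(\mathbb{A},\mathbb{B})$ if for every $R\in\tau_{\mathcal V}$, $R^{\mathbb{B}_{\mathcal V}}\supseteq\mathbb{A}^{\mathbb{B}}[\mathrm{var}(R^{\mathbb{A}_{\mathcal V}})]$ (tuples identified with assignments to the variables of the view), and for every base view $R_t$ (with $t\in R^{\mathbb A}$), $R_t^{\mathbb{B}_{\mathcal V}}\subseteq R^{\mathbb{B}}$. A decomposition method $\mathrm{DM}$ is a pair of polynomial-time computable functions $\ell\text{-DM}$, $r\text{-DM}$ such that for every CSP instance $(\mathbb{A},\mathbb{B})$, $\ell\text{-DM}(\mathbb{A})$ is a view structure for $\mathbb{A}$ and $r\text{-DM}(\mathbb{A},\mathbb{B})$ is legal w.r.t. $\ell\text{-DM}(\mathbb{A})$ and $(\mathbb{A},\mathbb{B})$. **GAC.** $\mathrm{GAC}(\mathbb{A}_{\mathcal V},\mathbb{B}_{\mathcal V})$ is the right-hand structure obtained from $\mathbb{B}_{\mathcal V}$ by deleting tuples until every two views having a nonempty set $\bar X$ of common variables have the same projection on $\bar X$ (the largest such sub-structure). **tp-covered pairs.** $\mathbb{S}_{\{X\}}$ is the structure with universe $\{X\}$ and one fresh unary symbol with relation $\{\langle X\rangle\}$. $(\mathbb{A},O)$ is tp-covered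 through $\mathrm{DM}$ if there is a core $\mathbb{A}'$ of $\mathbb{A}\uplus\biguplus_{X\in O}\mathbb{S}_{\{X\}}$ such that $(\mathcal{H}_{\mathbb{A}'},\mathcal{H}_{\ell\text{-DM}(\mathbb{A})})$ has a tree projection. **Domain restriction.** A variable $X$ is domain restricted in $\mathbb{A}$ if the vocabulary contains a distinguished unary symbol $\mathrm{dom}(X)$ with $\mathrm{dom}(X)^{\mathbb{A}}=\{\langle X\rangle\}$. A domain-restricted version of $(\mathbb{A},\mathbb{B},O)$ is obtained by adding, for every $X\in O$ that is not domain restricted, a fresh unary constraint $\mathrm{dom}(X)$ on $X$ whose values in the right-hand structure are those taken from (the column of $X$ in) any constraint relation where $X$ occurs; it has the same solutions. The base view of the constraint $\mathrm{dom}(X)$ is also denoted $\mathrm{dom}(X)$. **Algorithm $\mathtt{ComputeAllSolutions}_{\mathrm{DM}}$.** Input: an ECSP instance $(\mathbb{A},\mathbb{B},O)$, $O=\{X_1,\dots,X_m\}$. Replace $(\mathbb{A},\mathbb{B},O)$ by any of its domain-restricted versions; let $\mathbb{A}_{\mathcal V}:=\ell\text{-DM}(\mathbb{A})$, $\mathbb{B}_{\mathcal V}:=r\text{-DM}(\mathbb{A},\mathbb{B})$; call $\mathtt{Propagate}(1,(\mathbb{A}_{\mathcal V},\mathbb{B}_{\mathcal V}),m,\langle\rangle)$. The procedure $\mathtt{Propagate}(i,(\mathbb{A}_{\mathcal V},\mathbb{B}_{\mathcal V}),m,\langle a_1,\dots,a_{i-1}\rangle)$ is: let $\mathbb{B}'_{\mathcal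 V}:=\mathrm{GAC}(\mathbb{A}_{\mathcal V},\mathbb{B}_{\mathcal V})$; let $\mathit{activeValues}:=\mathrm{dom}(X_i)^{\mathbb{B}'_{\mathcal V}}$; for each $\langle a_i\rangle\in\mathit{activeValues}$: if $i=m$, output $\langle a_1,\dots,a_m\rangle$; otherwise set $\mathrm{dom}(X_i)^{\mathbb{B}'_{\mathcal V}}$ to $\{\langle a_i\rangle\}$ and call $\mathtt{Propagate}(i+1,(\mathbb{A}_{\mathcal V},\mathbb{B}'_{\mathcal V}),m,\langle a_1,\dots,a_i\rangle)$. An output $\langle a_1,\dots,a_m\rangle$ represents the map $X_j\mapsto a_j$ on $O$.
   Formalization: tp-coveredness is assumed of the left-hand structure after the algorithm's domain restriction of O (not of the original A), since the claim fails for an arbitrary DM whose views on the two structures are unrelated; relation symbols have positive arity. *)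

(* Defs.v *)
From HB Require Import structures.
From mathcomp Require Import all_boot all_order all_algebra finmap.

Set Implicit Arguments.
Unset Strict Implicit.
Unset Printing Implicit Defensive.

(* Binary trees are both the names of variables, values and symbols, and the
   data that programs compute on. *)
Inductive data := Leaf | Node of data & data.

Fixpoint tree_of_data (d : data) : GenTree.tree nat :=
  if d is Node a b then GenTree.Node 0 [:: tree_of_data a; tree_of_data b]
  else GenTree.Node 0 [::].

Fixpoint data_of_tree (t : GenTree.tree nat) : data :=
  if t is GenTree.Node _ [:: a; b] then Node (data_of_tree a) (data_of_tree b)
  else Leaf.

Lemma tree_of_dataK : cancel tree_of_data data_of_tree.
Proof. by elim=> //= a -> b ->. Qed.

HB.instance Definition _ := Countable.copy data (can_type tree_of_dataK).

Fixpoint dsize (d : data) : nat :=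
  if d is Node a b then (dsize a + dsize b).+1 else 1.

Definition dhead (d : data) : data := if d is Node a _ then a else Leaf.
Definition dtail (d : data) : data := if d is Node _ b then b else Leaf.
Definition dtrue : data := Node Leaf Leaf.
Definition deq (d : data) : data :=
  if d is Node a b then (if a == b then dtrue else Leaf) else Leaf.

(* A point-free version of Jones' WHILE language on binary trees.  A program
   maps one tree to one tree; [pEmit] outputs its argument and returns it. *)
Inductive prog :=
  | pId | pConst of data | pHead | pTail | pEq
  | pPair of prog & prog
  | pSeq of prog & prog
  | pIf of prog & prog & prog
  | pWhile of prog & prog
  | pEmit.

(* The trace of a run: [None] is one unit of time, [Some v] the output of v. *)
Definition trace := seq (option data).

Definition ticks (n : nat) : trace := nseq n None.

Definition outputs (tr : trace) : seq data := pmap id tr.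

(* Executing an instruction costs the size of the tree it is applied to (plus
   the size of the constant for [pConst]), so that the size of every intermediate
   tree is bounded by the elapsed time: up to a polynomial, this is the time of
   Turing machines. *)
Inductive exec : prog -> data -> trace -> data -> Prop :=
  | ExecId x : exec pId x (ticks (dsize x)) x
  | ExecConst d x : exec (pConst d) x (ticks (dsize x + dsize d)) d
  | ExecHead x : exec pHead x (ticks (dsize x)) (dhead x)
  | ExecTail x : exec pTail x (ticks (dsize x)) (dtail x)
  | ExecEq x : exec pEq x (ticks (dsize x)) (deq x)
  | ExecPair p q x t1 y t2 z :
      exec p x t1 y -> exec q x t2 z ->
      exec (pPair p q) x (ticks (dsize x) ++ t1 ++ t2) (Node y z)
  | ExecSeq p q x t1 y t2 z :
      exec p x t1 y -> exec q y t2 z ->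
      exec (pSeq p q) x (ticks (dsize x) ++ t1 ++ t2) z
  | ExecIfTrue c p q x t1 v t2 y :
      exec c x t1 v -> v <> Leaf -> exec p x t2 y ->
      exec (pIf c p q) x (ticks (dsize x) ++ t1 ++ t2) y
  | ExecIfFalse c p q x t1 t2 y :
      exec c x t1 Leaf -> exec q x t2 y ->
      exec (pIf c p q) x (ticks (dsize x) ++ t1 ++ t2) y
  | ExecWhileDone c p x t1 :
      exec c x t1 Leaf -> exec (pWhile c p) x (ticks (dsize x) ++ t1) x
  | ExecWhileLoop c p x t1 v t2 y t3 z :
      exec c x t1 v -> v <> Leaf -> exec p x t2 y -> exec (pWhile c p) y t3 z ->
      exec (pWhile c p) x (ticks (dsize x) ++ t1 ++ t2 ++ t3) z
  | ExecEmit x : exec pEmit x (ticks (dsize x) ++ [:: Some x]) x.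

(* f, restricted to dom, is computable in polynomial time w.r.t. the encodings
   eT and eU (silently: the trace contains no output). *)
Definition polytime (T U : Type) (eT : T -> data) (eU : U -> data)
    (dom : T -> Prop) (f : T -> U) : Prop :=
  exists (P : prog) (p : {poly nat}), forall x, dom x ->
    exists2 k, k <= (p.[dsize (eT x)])%R & exec P (eT x) (ticks k) (eU (f x)).

Record relation (S : eqType) := Rel
  { rsym : S; rar : nat; rtup : seq (seq data) }.

(* Structures over a vocabulary of symbols taken from S.  All finite sets are
   given by lists, as they are when structures are passed to programs. *)
Record structure (S : eqType) := Str
  { univ : seq data; rels : seq (relation S) }.

Section Structures.
Variable S : eqType.
Implicit Types (A B : structure S) (R : S).

Definition symbols A : seq S := [seq rsym r | r <- rels A].
Definition voc A : seq (S * nat) := [seq (rsym r, rar r) | r <- rels A].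

(* R^A; empty if R is not in the vocabulary *)
Definition tuples A R : seq (seq data) :=
  flatten [seq rtup r | r <- rels A & rsym r == R].

(* Symbols have positive arity. *)
Definition wf_rel (U : seq data) (r : relation S) : bool :=
  [&& 0 < rar r, uniq (rtup r) &
      all (fun t => (size t == rar r) && all (mem U) t) (rtup r)].

Definition wf A : bool :=
  [&& uniq (univ A), uniq (symbols A) & all (wf_rel (univ A)) (rels A)].

Definition hom (h : data -> data) A B : Prop :=
  (forall x, x \in univ A -> h x \in univ B) /\
  (forall R t, t \in tuples A R -> map h t \in tuples B R).

Definition substructure A' A : Prop :=
  [/\ wf A', voc A' =i voc A, {subset univ A' <= univ A} &
      forall R, {subset tuples A' R <= tuples A R}].

(* [substructure A' A''] below says that the substructure A'' of A' is A'. *)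
Definition core A' A : Prop :=
  [/\ substructure A' A, (exists h, hom h A A') &
      forall A'', substructure A'' A' -> (exists h, hom h A A'') ->
                  substructure A' A''].

End Structures.

Definition map_rel (S T : eqType) (f : S -> T) (r : relation S) : relation T :=
  Rel (f (rsym r)) (rar r) (rtup r).

Definition disjoint_union (S T : eqType) (A : structure S) (A' : structure T) :
    structure (S + T)%type :=
  Str (undup (univ A ++ univ A'))
      (map (map_rel inl) (rels A) ++ map (map_rel inr) (rels A')).

(* The disjoint union of the structures S_{X}, X in O; the fresh symbol of
   S_{X} is X itself. *)
Definition singletons (O : seq data) : structure data :=
  Str O [seq Rel X 1 [:: [:: X]] | X <- O].

Local Open Scope fset_scope.

Record hypergraph := Hyper { nodes : {fset data}; edges : {fset {fset data}} }.

Definition wf_hyper (H : hypergraph) : Prop :=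
  forall e, e \in edges H -> e `<=` nodes H.

Definition fset_of (s : seq data) : {fset data} := [fset x in s].

Definition hyper (S : eqType) (A : structure S) : hypergraph :=
  Hyper (fset_of (univ A))
        [fset fset_of t | t in flatten [seq rtup r | r <- rels A]].

Definition adjacent (H : hypergraph) (x y : data) : bool :=
  has (fun e : {fset data} => (x \in e) && (y \in e)) (edges H).

Definition connected_hyper (H : hypergraph) : Prop :=
  forall x y, x \in nodes H -> y \in nodes H ->
  exists2 p, path (adjacent H) x p & last x p = y.

Definition connected (S : eqType) (A : structure S) : Prop :=
  connected_hyper (hyper A).

Definition simple_path (T : choiceType) (V : {fset T}) (r : rel T)
    (u v : T) (p : seq T) : Prop :=
  [/\ {subset u :: p <= V}, path r u p, uniq (u :: p) & last u p = v].

Definition tree (T : choiceType) (V : {fset T}) (r : rel T) : Prop :=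
  [/\ symmetric r, irreflexive r &
      forall u v, u \in V -> v \in V -> exists! p, simple_path V r u v p].

Definition join_tree (H : hypergraph) (r : rel {fset data}) : Prop :=
  tree (edges H) r /\
  forall u v p, u \in edges H -> v \in edges H ->
    simple_path (edges H) r u v p ->
  forall x, x \in u -> x \in v -> forall w, w \in u :: p -> x \in w.

Definition acyclic (H : hypergraph) : Prop := exists r, join_tree H r.

Definition covered (H1 H2 : hypergraph) : Prop :=
  forall e, e \in edges H1 -> exists2 e', e' \in edges H2 & e `<=` e'.

Definition tree_projection (H1 H2 Ha : hypergraph) : Prop :=
  [/\ wf_hyper Ha, acyclic Ha, covered H1 Ha & covered Ha H2].

Local Close Scope fset_scope.

(* Symbols of CSP instances: [Dom X] is the distinguished symbol dom(X). *)
Inductive sym := Sym of data | Dom of data.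

Definition sum_of_sym (s : sym) : data + data :=
  match s with Sym d => inl d | Dom x => inr x end.
Definition sym_of_sum (s : data + data) : sym :=
  match s with inl d => Sym d | inr x => Dom x end.
Lemma sum_of_symK : cancel sum_of_sym sym_of_sum. Proof. by case. Qed.
HB.instance Definition _ := Countable.copy sym (can_type sum_of_symK).

(* Symbols of view structures: [Base R t] is the base view R_t. *)
Inductive vsym := Base of sym & seq data | Extra of data.

Definition sum_of_vsym (s : vsym) : (sym * seq data) + data :=
  match s with Base R t => inl (R, t) | Extra d => inr d end.
Definition vsym_of_sum (s : (sym * seq data) + data) : vsym :=
  match s with inl (R, t) => Base R t | inr d => Extra d end.
Lemma sum_of_vsymK : cancel sum_of_vsym vsym_of_sum. Proof. by case. Qed.
HB.instance Definition _ := Countable.copy vsym (can_type sum_of_vsymK).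

(* The symbol dom(X) is reserved for the domain constraint of X. *)
Definition left_hand (A : structure sym) : bool :=
  wf A && all (fun r => if rsym r is Dom X then rtup r == [:: [:: X]] else true)
              (rels A).

Definition csp_instance (A B : structure sym) : Prop :=
  [/\ left_hand A, wf B & voc A =i voc B].

(* The output variables are listed as X_1, ..., X_m. *)
Definition ecsp_instance (A B : structure sym) (O : seq data) : Prop :=
  [/\ csp_instance A B, uniq O, 0 < size O & {subset O <= univ A}].

(* s is (the tuple of values on O of) an element of A^B[O]. *)
Definition solution (A B : structure sym) (O s : seq data) : Prop :=
  exists2 h, hom h A B & s = map h O.

Definition vtuple (AV : structure vsym) (R : vsym) : seq data :=
  head [::] (tuples AV R).

Definition view_structure (A : structure sym) (AV : structure vsym) : Prop :=
  [/\ wf AV, univ AV =i univ A,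
      all (fun r => size (rtup r) == 1) (rels AV) &
      forall R t, t \in tuples A R ->
        Base R t \in symbols AV /\ vtuple AV (Base R t) = t].

Definition legal (AV BV : structure vsym) (A B : structure sym) : Prop :=
  [/\ wf BV, voc BV =i voc AV,
      (forall R h, R \in symbols AV -> hom h A B ->
         map h (vtuple AV R) \in tuples BV R) &
      forall R t, t \in tuples A R ->
        {subset tuples BV (Base R t) <= tuples B R}].

Fixpoint of_seq (s : seq data) : data :=
  if s is x :: s' then Node x (of_seq s') else Leaf.

Definition of_nat (n : nat) : data := of_seq (nseq n Leaf).

Definition of_sym (s : sym) : data :=
  match s with Sym d => Node Leaf d | Dom x => Node dtrue x end.

Definition of_vsym (s : vsym) : data :=
  match s with
  | Base R t => Node Leaf (Node (of_sym R) (of_seq t))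
  | Extra d => Node dtrue d
  end.

Definition of_rel (S : eqType) (eS : S -> data) (r : relation S) : data :=
  Node (eS (rsym r)) (Node (of_nat (rar r)) (of_seq (map of_seq (rtup r)))).

Definition of_str (S : eqType) (eS : S -> data) (A : structure S) : data :=
  Node (of_seq (univ A)) (of_seq (map (of_rel eS) (rels A))).

Definition of_csp (AB : structure sym * structure sym) : data :=
  Node (of_str of_sym AB.1) (of_str of_sym AB.2).

Record decomposition_method := DecompositionMethod {
  lDM : structure sym -> structure vsym;
  rDM : structure sym -> structure sym -> structure vsym;
  lDM_polytime : polytime (of_str of_sym) (of_str of_vsym) left_hand lDM;
  rDM_polytime : polytime of_csp (of_str of_vsym)
                   (fun AB => csp_instance AB.1 AB.2) (fun AB => rDM AB.1 AB.2);
  lDM_view : forall A, left_hand A -> view_structure A (lDM A);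
  rDM_legal : forall A B, csp_instance A B -> legal (lDM A) (rDM A B) A B }.

Definition tp_covered (DM : decomposition_method) (A : structure sym)
    (O : seq data) : Prop :=
  exists2 A', core A' (disjoint_union A (singletons O)) &
  exists Ha, tree_projection (hyper A') (hyper (lDM DM A)) Ha.

(* As assignments to the variables of t and t', the tuples b and b' agree on
   the common variables.  A tuple giving two values to one variable is not an
   assignment, and agrees with no tuple over that variable. *)
Definition agree (t b t' b' : seq data) : bool :=
  allrel (fun u v : data * data => (u.1 == v.1) ==> (u.2 == v.2))
         (zip t b) (zip t' b').

Definition supported (AV BV : structure vsym) (R : vsym) (b : seq data) : bool :=
  all (fun R' => has (mem (vtuple AV R)) (vtuple AV R') ==>
                 has (agree (vtuple AV R) b (vtuple AV R')) (tuples BV R'))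
      (symbols AV).

Definition prune (AV BV : structure vsym) : structure vsym :=
  Str (univ BV)
      [seq Rel (rsym r) (rar r) [seq b <- rtup r | supported AV BV (rsym r) b]
      | r <- rels BV].

(* Unsupported tuples are deleted until there are none: a round that changes
   something deletes a tuple, hence the number of rounds below suffices.  By
   [consistent_gac] and [gac_largest] below, the result is the largest
   substructure in which any two views with common variables have the same
   projection on them. *)
Definition gac (AV BV : structure vsym) : structure vsym :=
  iter (sumn [seq size (rtup r) | r <- rels BV]) (prune AV) BV.

(* The projection of the view R on the variables xs: the restrictions to xs of
   the assignments to the variables of R that are tuples of R. *)
Definition projection (AV BV : structure vsym) (R : vsym) (xs v : seq data) :=
  exists2 f : data -> data,
    map f (vtuple AV R) \in tuples BV R & v = map f xs.

Definition common (AV : structure vsym) (R R' : vsym) : seq data :=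
  [seq x <- vtuple AV R | x \in vtuple AV R'].

Definition consistent (AV BV : structure vsym) : Prop :=
  (forall R b, R \in symbols AV -> b \in tuples BV R ->
     exists f : data -> data, b = map f (vtuple AV R)) /\
  (forall R R', R \in symbols AV -> R' \in symbols AV ->
     common AV R R' <> [::] -> forall v,
     projection AV BV R (common AV R R') v <->
     projection AV BV R' (common AV R R') v).

Section GacLargest.

Implicit Types AV BV : structure vsym.

Let total BV := sumn [seq size (rtup r) | r <- rels BV].

Lemma tuples_voc (S : eqType) (A : structure S) R t :
  wf A -> t \in tuples A R -> (R, size t) \in voc A.
Proof.
case: A => U s /and3P[_ _] /=; rewrite /tuples /voc /=.
elim: s => //= r s IHs /andP[/and3P[_ _ /allP wf_r] /IHs{}IHs].
case: eqP => [rR|_] /=; last by move=> /IHs; rewrite in_cons orbC => ->.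
rewrite mem_cat in_cons => /orP[/wf_r/andP[/eqP-> _]|/IHs->]; last by rewrite orbT.
by rewrite rR eqxx.
Qed.

Lemma voc_inj (S : eqType) (A : structure S) R m n :
  wf A -> (R, m) \in voc A -> (R, n) \in voc A -> m = n.
Proof.
case: A => U s /and3P[_ + _]; rewrite /symbols /voc /=.
elim: s => //= r s IHs /andP[notin_r /IHs{}IHs].
have in_r k : (rsym r, k) \in [seq (rsym r, rar r) | r <- s] -> false.
  move=> /(map_f fst); rewrite -map_comp => in_s.
  by case/negP: notin_r.
rewrite !in_cons => /orP[/eqP[eqR eqm]|Rm] /orP[/eqP[eqR' eqn]|Rn].
- by rewrite eqm eqn.
- by move: Rn; rewrite eqR => /in_r.
- by move: Rm; rewrite eqR' => /in_r.
exact: IHs.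
Qed.

Lemma vtupleP A AV R : view_structure A AV -> R \in symbols AV ->
  vtuple AV R \in tuples AV R.
Proof.
case=> _ _ + _; case: AV => U s; rewrite /vtuple /tuples /symbols /=.
elim: s => //= r s IHs /andP[/eqP size_r /IHs{}IHs]; rewrite in_cons eq_sym.
case: eqP => [_ _|_ /IHs//] /=.
by case: (rtup r) size_r => //= t ts _; rewrite in_cons eqxx.
Qed.

Lemma size_view A AV BV R b :
  view_structure A AV -> wf BV -> voc BV =i voc AV -> R \in symbols AV ->
  b \in tuples BV R -> size b = size (vtuple AV R).
Proof.
move=> viewAV wfBV eqV AV_R /(tuples_voc wfBV); rewrite eqV.
have [wfAV _ _ _] := viewAV => Rb.
exact: voc_inj wfAV Rb (tuples_voc wfAV (vtupleP viewAV AV_R)).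
Qed.

Lemma agreeP (t b t' b' : seq data) : size b = size t -> size b' = size t' ->
  reflect (forall i j, i < size t -> j < size t' ->
             nth Leaf t i = nth Leaf t' j -> nth Leaf b i = nth Leaf b' j)
          (agree t b t' b').
Proof.
move=> eq_b eq_b'.
have sz s s' : size s' = size s -> size (zip s s') = size s :> nat.
  by move=> e; rewrite size_zip e minnn.
apply: (iffP allrelP) => [agr i j lt_i lt_j eq_ij|agr u v].
  have := agr (nth (Leaf, Leaf) (zip t b) i) (nth (Leaf, Leaf) (zip t' b') j).
  rewrite !mem_nth ?sz // !nth_zip //= eq_ij eqxx /=.
  by move=> /(_ isT isT)/eqP.
case/(nthP (Leaf, Leaf)) => i; rewrite sz // => lt_i <-.
case/(nthP (Leaf, Leaf)) => j; rewrite sz // => lt_j <-.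
by rewrite !nth_zip //=; apply/implyP => /eqP eq_ij; apply/eqP/agr.
Qed.

Lemma agree_map (f f' : data -> data) t t' :
  (forall x, x \in t -> x \in t' -> f x = f' x) ->
  agree t (map f t) t' (map f' t').
Proof.
move=> eqf; apply/agreeP; rewrite ?size_map // => i j lt_i lt_j eq_ij.
rewrite !(nth_map Leaf) // -eq_ij; apply: eqf; first exact: mem_nth.
by rewrite eq_ij mem_nth.
Qed.

Lemma agree_fun t b b' : size b = size t -> size b' = size t ->
  agree t b t b' -> exists f, b = map f t.
Proof.
move=> eq_b eq_b' /(agreeP eq_b eq_b') agr.
exists (fun x => nth Leaf b (index x t)).
apply: (@eq_from_nth _ Leaf); rewrite ?size_map // => i; rewrite eq_b => lt_i.
have t_i: nth Leaf t i \in t by exact: mem_nth.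
have lt_j: index (nth Leaf t i) t < size t by rewrite index_mem.
rewrite (nth_map Leaf) // (agr i (index (nth Leaf t i) t)) ?nth_index //.
by apply/esym/agr; rewrite ?nth_index.
Qed.

Lemma mem_prune AV BV R b :
  (b \in tuples (prune AV BV) R) =
  (b \in tuples BV R) && supported AV BV R b.
Proof.
rewrite /tuples /= filter_map -map_comp /=.
rewrite (eq_filter (a2 := fun r => rsym r == R)) //.
elim: (rels BV) => //= r s IHs; case: eqP => [rR|_] //=.
by rewrite !mem_cat mem_filter IHs rR; case: (supported _ _ _ _);
   rewrite ?andbT ?andbF ?orbF.
Qed.

Lemma prune_total AV BV :
  total (prune AV BV) <= total BV /\
  (total (prune AV BV) = total BV -> prune AV BV = BV).
Proof.
case: BV => U s; rewrite /total /prune /=.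
set P := supported _ _; elim: s P => //= -[R n bs] s IHs P /=.
have [le_s eq_s] := IHs P; rewrite size_filter.
have le_bs := count_size (P R) bs; split; first exact: leq_add.
move=> eq_sum.
have eq_bs: count (P R) bs = size bs.
  apply/eqP; rewrite eqn_leq le_bs /=.
  by rewrite -(leq_add2r (sumn [seq size (rtup r) | r <- s])) -eq_sum leq_add2l.
move: eq_sum; rewrite eq_bs => /addnI/eq_s[->].
by congr (Str _ (Rel _ _ _ :: _)); apply/all_filterP; rewrite all_count eq_bs.
Qed.

Lemma prune_gac AV BV : prune AV (gac AV BV) = gac AV BV.
Proof.
suff fix_n n B : total B <= n ->
    prune AV (iter n (prune AV) B) = iter n (prune AV) B.
  exact: fix_n (leqnn _).
elim: n B => [|n IHn] B le_n; have [le1 eq1] := prune_total AV B.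
  apply: eq1; apply/eqP; move: le_n le1; rewrite leqn0 => /eqP->.
  by rewrite leqn0.
rewrite iterSr; have [lt1|ge1] := ltnP (total (prune AV B)) (total B).
  by apply: IHn; rewrite -ltnS (leq_trans lt1).
have fixB: prune AV B = B by apply: eq1; apply/eqP; rewrite eqn_leq le1.
have fixI m : iter m (prune AV) B = B by elim: m => //= m ->.
by rewrite fixB fixI.
Qed.

Lemma gac_sub AV BV R : {subset tuples (gac AV BV) R <= tuples BV R}.
Proof.
rewrite /gac; elim: (sumn _) => //= n IHn b.
by rewrite mem_prune => /andP[/IHn].
Qed.

Lemma consistent_gac A AV BV :
  view_structure A AV -> wf BV -> voc BV =i voc AV ->
  consistent AV (gac AV BV).
Proof.
move=> viewAV wfBV eqV; have [wfAV _ _ _] := viewAV.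
have sz R b : R \in symbols AV -> b \in tuples (gac AV BV) R ->
    size b = size (vtuple AV R).
  by move=> AV_R /gac_sub gac_b; exact: size_view viewAV wfBV eqV AV_R gac_b.
have supp R b R' : R \in symbols AV -> R' \in symbols AV ->
    b \in tuples (gac AV BV) R -> has (mem (vtuple AV R)) (vtuple AV R') ->
    exists2 b', b' \in tuples (gac AV BV) R'
              & agree (vtuple AV R) b (vtuple AV R') b'.
  move=> AV_R AV_R'; rewrite -{1}prune_gac mem_prune => /andP[_ /allP/(_ R' AV_R')].
  by move=> /implyP imp /imp/hasP.
have fn R b : R \in symbols AV -> b \in tuples (gac AV BV) R ->
    exists f, b = map f (vtuple AV R).
  move=> AV_R gac_b; have [t0|] := eqVneq (vtuple AV R) [::].
    by exists id; move: (sz _ _ AV_R gac_b); rewrite t0 => /eqP; rewrite size_eq0 => /eqP.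
  move=> tn0; have [|b' gac_b' agr] := supp R b R AV_R AV_R gac_b.
    by case: (vtuple AV R) tn0 => //= x t _; rewrite in_cons eqxx.
  by apply: (agree_fun _ _ agr); apply: sz.
have half R R' xs : R \in symbols AV -> R' \in symbols AV -> xs <> [::] ->
    {subset xs <= vtuple AV R} -> {subset xs <= vtuple AV R'} -> forall v,
    projection AV (gac AV BV) R xs v -> projection AV (gac AV BV) R' xs v.
  move=> AV_R AV_R' xs_n0 xsR xsR' v [f gac_f ->].
  have has_RR' : has (mem (vtuple AV R)) (vtuple AV R').
    case: xs xs_n0 xsR xsR' => // x xs _ xsR xsR'; apply/hasP; exists x.
      by apply: xsR'; rewrite in_cons eqxx.
    by apply: xsR; rewrite in_cons eqxx.
  have [b' gac_b' agr] := supp _ _ _ AV_R AV_R' gac_f has_RR'.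
  have [f' eq_b'] := fn _ _ AV_R' gac_b'; exists f'; rewrite -?eq_b' //.
  apply/eq_in_map => x xs_x; move: agr; rewrite eq_b' => /agreeP.
  rewrite !size_map => /(_ erefl erefl).
  move=> /(_ (index x (vtuple AV R)) (index x (vtuple AV R'))).
  have xR := xsR _ xs_x; have xR' := xsR' _ xs_x.
  by rewrite !index_mem !(nth_map Leaf) ?index_mem // !nth_index //; apply.
split=> // R R' AV_R AV_R' xs_n0 v.
by split; apply: half => // x; rewrite mem_filter => /andP[].
Qed.

Lemma gac_largest AV BV BV' :
  (forall R, {subset tuples BV' R <= tuples BV R}) -> consistent AV BV' ->
  forall R, R \in symbols AV ->
  {subset tuples BV' R <= tuples (gac AV BV) R}.
Proof.
move=> sub [fn proj]; rewrite /gac; elim: (sumn _) => [|n IHn] //= R AV_R b BV'_b.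
rewrite mem_prune IHn //=; apply/allP => R' AV_R'; apply/implyP => common_RR'.
have [f eq_b] := fn _ _ AV_R BV'_b; rewrite eq_b in BV'_b *.
have cn0: common AV R R' <> [::].
  move=> c0; case/hasP: common_RR' => x xR' xR.
  have: x \in common AV R R' by rewrite mem_filter xR'.
  by rewrite c0.
have := proj _ _ AV_R AV_R' cn0 (map f (common AV R R')).
case=> /(_ (ex_intro2 _ _ f BV'_b erefl))[f' BV'_f' /eq_in_map eqf] _.
apply/hasP; exists (map f' (vtuple AV R')); first exact: IHn.
apply: agree_map => x xR xR'; apply: eqf; by rewrite mem_filter xR'.
Qed.

End GacLargest.

Definition restricted (A : structure sym) (X : data) : bool :=
  Dom X \in symbols A.

(* the columns of X in the constraint relations where X occurs *)
Definition columns (A B : structure sym) (X : data) : seq (seq data) :=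
  flatten
    [seq flatten
      [seq [seq [seq nth Leaf b k | b <- tuples B (rsym r)]
           | k <- iota 0 (size t) & nth Leaf t k == X]
      | t <- rtup r]
    | r <- rels A].

(* A domain-restricted version of an instance is given by the choice, for each
   variable X_j, of the index c_j of one of the columns of X_j. *)
Definition column_choice (A B : structure sym) (O : seq data) (c : seq nat) :=
  size c = size O /\
  forall X, X \in O -> nth 0 c (index X O) < size (columns A B X).

Definition restrict_left (A : structure sym) (O : seq data) : structure sym :=
  Str (univ A)
      (rels A ++ [seq Rel (Dom X) 1 [:: [:: X]] | X <- O & ~~ restricted A X]).

Definition restrict_right (A B : structure sym) (O : seq data) (c : seq nat) :
    structure sym :=
  Str (univ B)
      (rels B ++
       [seq Rel (Dom X) 1
              [seq [:: v]
              | v <- undup (nth [::] (columns A B X) (nth 0 c (index X O)))]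
       | X <- O & ~~ restricted A X]).

Definition dom_view (X : data) : vsym := Base (Dom X) [:: X].

Definition set_tuples (BV : structure vsym) (R : vsym) (bs : seq (seq data)) :
    structure vsym :=
  Str (univ BV)
      [seq if rsym r == R then Rel R (rar r) bs else r | r <- rels BV].

(* Xs is X_i, ..., X_m and pre is a_1, ..., a_(i-1); the result is the list of
   the outputs, in order. *)
Fixpoint Propagate (AV : structure vsym) (Xs : seq data) (BV : structure vsym)
    (pre : seq data) : seq (seq data) :=
  if Xs is X :: Xs' then
    let BV' := gac AV BV in
    let activeValues := [seq head Leaf b | b <- tuples BV' (dom_view X)] in
    flatten
      [seq if Xs' is [::] then [:: rcons pre a]
           else Propagate AV Xs' (set_tuples BV' (dom_view X) [:: [:: a]])
                          (rcons pre a)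
      | a <- activeValues]
  else [::].

Definition ComputeAllSolutions (DM : decomposition_method) (A B : structure sym)
    (O : seq data) (c : seq nat) : seq (seq data) :=
  let A1 := restrict_left A O in
  let B1 := restrict_right A B O c in
  Propagate (lDM DM A1) O (rDM DM A1 B1) [::].

Definition of_ecsp (A B : structure sym) (O : seq data) : data :=
  Node (of_csp (A, B)) (of_seq O).

(* The choices made by the algorithm are passed along with the instance. *)
Definition input (A B : structure sym) (O : seq data) (c : seq nat) : data :=
  Node (of_ecsp A B O) (of_seq (map of_nat c)).

(* P outputs what the algorithm outputs, on all instances and for all choices *)
Definition implements (P : prog) (DM : decomposition_method) : Prop :=
  forall A B O c, ecsp_instance A B O -> column_choice A B O c ->
  exists tr y, exec P (input A B O c) tr y /\
    outputs tr = map of_seq (ComputeAllSolutions DM A B O c).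

(* The run with trace tr, on an instance of size n, enumerates the solutions
   (each of them once) with delay bounded by p(n): every output is preceded by at
   most p(n) units of time since the previous output, or since the start. *)
Definition WPD_run (p : {poly nat}) (n : nat) (sol : seq data -> Prop)
    (tr : trace) : Prop :=
  exists outs : seq (seq data),
  [/\ outputs tr = map of_seq outs,
      uniq outs /\ (forall s, s \in outs <-> sol s),
      ((forall s, ~ sol s) -> size tr <= (p.[n])%R) &
      forall tr1 k v tr2, tr = tr1 ++ ticks k ++ Some v :: tr2 ->
        k <= (p.[n])%R].

Definition runs_WPD (P : prog) (p : {poly nat}) (A B : structure sym)
    (O : seq data) (c : seq nat) : Prop :=
  exists tr y, exec P (input A B O c) tr y /\
    WPD_run p (dsize (of_ecsp A B O)) (solution A B O) tr.

(* Main.v *)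
Require Import Defs.
From mathcomp Require Import all_boot all_order all_algebra.
From HB Require Import structures.
From mathcomp Require Import finmap zify.
(* [all_algebra] shadows [hom]. *)
Require Import Defs.

Set Implicit Arguments.
Unset Strict Implicit.
Unset Printing Implicit Defensive.

(* Let h be a homomorphism from A + {X} (X in O) to its core A'; it fixes the
   variables of O, because each carries its own fresh unary symbol.  After GAC the
   views have equal projections on nonempty sets of common variables and, A being
   connected, all are nonempty as soon as one is.  Hence a tuple of one edge of a
   tree projection can be extended, edge by edge along the join tree, to an
   assignment f that is locally consistent with the views of all edges, and f o h is
   a homomorphism from A to B that agrees with f on O.  So every active value of
   X_i extends to a solution, the recursion never meets a dead end, and at most
   |O| + 1 calls separate two outputs.

   The program simulates the recursion by a loop on a stack of pending calls.  It is
   obtained from closure properties of the polynomial-time functions between types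
   of encoded objects: such a function is never given by an explicit program, only
   composed from bounded folds over lists. *)

(** * Polynomially bounded functions *)

(** GAC runs again after every assignment, so the extension argument must hold for each right-hand
    structure met in the recursion. It therefore rests on the half of legality that survives every
    deletion of tuples: base views are contained in the relations of B. The other half, that the
    views contain the restrictions of homomorphisms, serves completeness and survives for the
    homomorphisms that take the values chosen so far. The extension also stays inside the domain
    views of all variables of O; for assigned variables these are singletons, so a new value is
    extended compatibly with the earlier ones. The polynomial must not depend on the instance. GAC
    and assignments only delete tuples, hence no view structure outgrows the initial one; a call is
    replaced by its subcalls on the stack, so no time goes into returning from it. The chosen
    columns belong to the input but not to the size in which the delay is measured; their unary
    indices are bounded by the numbers of columns. *)

Lemma leq_horner (p : {poly nat}) m n : m <= n -> p.[m]%R <= p.[n]%R.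
Proof.
move=> le_mn; rewrite !horner_coef.
by apply: leq_sum => i _; apply: leq_mul => //; elim: (val i) => // k IHk;
   rewrite !GRing.exprS; apply: leq_mul.
Qed.

Class encoding (T : Type) := enc : T -> data.
(* Without a mode, an arbitrary encoding would be chosen for a type that is not
   known yet. *)
#[global] Hint Mode encoding ! : typeclass_instances.

#[global] Instance enc_data : encoding data := id.
#[global] Instance enc_bool : encoding bool := fun b => if b then dtrue else Leaf.
#[global] Instance enc_unit : encoding unit := fun=> Leaf.
#[global] Instance enc_nat : encoding nat := of_nat.
#[global] Instance enc_pair T U `{encoding T} `{encoding U} : encoding (T * U) :=
  fun x => Node (enc x.1) (enc x.2).
#[global] Instance enc_seq T `{encoding T} : encoding (seq T) :=
  fun s => of_seq (map enc s).

Definition esize T `{encoding T} (x : T) := dsize (enc x).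

Lemma esize_gt0 T `{encoding T} (x : T) : 0 < esize x.
Proof. by rewrite /esize; case: (enc x). Qed.

Lemma esize_pair T U `{encoding T} `{encoding U} (x : T) (y : U) :
  esize (x, y) = (esize x + esize y).+1.
Proof. by []. Qed.

Lemma esize_cons T `{encoding T} (x : T) s :
  esize (x :: s) = (esize x + esize s).+1.
Proof. by []. Qed.

Lemma esize_nil T `{encoding T} : esize (Nil T) = 1.
Proof. by []. Qed.

Lemma esize_nat n : esize n = n.*2.+1.
Proof.
rewrite /esize /enc /enc_nat /of_nat.
by elim: n => //= n ->; rewrite doubleS; lia.
Qed.

Lemma esize_catl T `{encoding T} (s t : seq T) : esize (s ++ t) + 1 = esize s + esize t.
Proof.
elim: s => [|x s IHs] /=; first by rewrite esize_nil addnC.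
by rewrite !esize_cons !addSn -addnA IHs addnA.
Qed.

Lemma esize_mem (T : eqType) `{encoding T} (x : T) s :
  x \in s -> esize x < esize s.
Proof.
elim: s => //= y s IHs; rewrite in_cons esize_cons => /orP[/eqP->|/IHs]; lia.
Qed.

Lemma size_esize T `{encoding T} (s : seq T) : size s < esize s.
Proof. by elim: s => //= x s IHs; rewrite esize_cons; lia. Qed.

Definition pbounded T `{encoding T} (f : T -> nat) : Prop :=
  exists p : {poly nat}, forall x, f x <= p.[esize x]%R.

Section PBounded.
Context (T : Type) {eT : encoding T}.
Implicit Types f g : T -> nat.

Lemma pbounded_le f g : (forall x, f x <= g x) -> pbounded g -> pbounded f.
Proof. by move=> le_fg [p le_g]; exists p => x; apply: leq_trans (le_g x). Qed.

Lemma pbounded_size : pbounded (@esize T eT).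
Proof. by exists 'X%R => x; rewrite hornerX. Qed.

Lemma pbounded_const n : pbounded (fun _ : T => n).
Proof. by exists (n%:P)%R => x; rewrite hornerC. Qed.

Lemma pboundedD f g : pbounded f -> pbounded g -> pbounded (fun x => f x + g x).
Proof.
move=> [p le_f] [q le_g]; exists (p + q)%R => x.
by rewrite hornerD; apply: leq_add; [apply: le_f | apply: le_g].
Qed.

Lemma pboundedS f : pbounded f -> pbounded (fun x => (f x).+1).
Proof.
move=> bf; apply: pbounded_le (pboundedD bf (pbounded_const 1)) => x.
by rewrite addn1.
Qed.

Lemma pboundedM f g : pbounded f -> pbounded g -> pbounded (fun x => f x * g x).
Proof.
move=> [p le_f] [q le_g]; exists (p * q)%R => x.
by rewrite hornerM; apply: leq_mul; [apply: le_f | apply: le_g].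
Qed.

Lemma pbounded_horner (p : {poly nat}) f :
  pbounded f -> pbounded (fun x => p.[f x]%R).
Proof.
move=> [q le_f]; exists (p \Po q)%R => x.
by rewrite horner_comp; apply: leq_horner.
Qed.

End PBounded.
Arguments pbounded_size {T eT}.
Arguments pbounded_const {T eT} n.

(** * Closure properties of the polynomial-time functions *)

(** Every instruction pays for the tree that it reads, so time bounds size. Hence the second program
    of a sequence starts from a tree no larger than the time already spent, and polynomial time is
    closed under composition. *)
Lemma exec_size P x tr y : exec P x tr y -> dsize y <= size tr.
Proof.
elim=> {P x tr y} /=.
- by move=> x; rewrite size_nseq.
- by move=> d x; rewrite size_nseq leq_addl.
- by case=> //= a b; rewrite size_nseq; lia.
- by case=> //= a b; rewrite size_nseq; lia.
- case=> [|a b]; rewrite size_nseq //=; case: eqP => //= ->.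
  by case: b => //= c d; lia.
- by move=> p q x t1 y t2 z _ IH1 _ IH2; rewrite !size_cat size_nseq;
    case: x => /=; lia.
- by move=> p q x t1 y t2 z _ IH1 _ IH2; rewrite !size_cat; lia.
- by move=> c p q x t1 v t2 y _ _ _ _ IH; rewrite !size_cat; lia.
- by move=> c p q x t1 t2 y _ _ _ IH; rewrite !size_cat; lia.
- by move=> c p x t1 _ IH; rewrite !size_cat size_nseq; lia.
- by move=> c p x t1 v t2 y t3 z _ _ _ _ _ _ IH; rewrite !size_cat; lia.
- by move=> x; rewrite size_cat size_nseq; lia.
Qed.

Definition computes (P : prog) (t : nat) (x y : data) : Prop :=
  exists2 k, k <= t & exec P x (ticks k) y.

Lemma computes_le P t t' x y : t <= t' -> computes P t x y -> computes P t' x y.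
Proof. by move=> le_t [k le_k run]; exists k => //; apply: leq_trans le_t. Qed.

Lemma computes_size P t x y : computes P t x y -> dsize y <= t.
Proof. by case=> k le_k /exec_size; rewrite size_nseq => /leq_trans; apply. Qed.

Lemma ticksD m n : ticks (m + n) = ticks m ++ ticks n.
Proof. by rewrite /ticks nseqD. Qed.

Lemma computes_id x : computes pId (dsize x) x x.
Proof. by exists (dsize x) => //; apply: ExecId. Qed.

Lemma computes_const d x : computes (pConst d) (dsize x + dsize d) x d.
Proof. by exists (dsize x + dsize d) => //; apply: ExecConst. Qed.

Lemma computes_head x : computes pHead (dsize x) x (dhead x).
Proof. by exists (dsize x) => //; apply: ExecHead. Qed.

Lemma computes_tail x : computes pTail (dsize x) x (dtail x).
Proof. by exists (dsize x) => //; apply: ExecTail. Qed.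

Lemma computes_eq x : computes pEq (dsize x) x (deq x).
Proof. by exists (dsize x) => //; apply: ExecEq. Qed.

Lemma computes_pair P Q t1 t2 x y z : computes P t1 x y -> computes Q t2 x z ->
  computes (pPair P Q) (dsize x + (t1 + t2)) x (Node y z).
Proof.
move=> [k1 le1 run1] [k2 le2 run2]; exists (dsize x + (k1 + k2)); first by lia.
by rewrite !ticksD; apply: ExecPair.
Qed.

Lemma computes_seq P Q t1 t2 x y z : computes P t1 x y -> computes Q t2 y z ->
  computes (pSeq P Q) (dsize x + (t1 + t2)) x z.
Proof.
move=> [k1 le1 run1] [k2 le2 run2]; exists (dsize x + (k1 + k2)); first by lia.
by rewrite !ticksD; apply: ExecSeq run2.
Qed.

Lemma computes_if C P Q t1 t2 x v y : computes C t1 x v ->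
  computes (if v is Leaf then Q else P) t2 x y ->
  computes (pIf C P Q) (dsize x + (t1 + t2)) x y.
Proof.
move=> [k1 le1 run1] [k2 le2 run2]; exists (dsize x + (k1 + k2)); first by lia.
rewrite !ticksD; case: v run1 run2 => [|a b] run1 run2; first exact: ExecIfFalse.
by apply: ExecIfTrue run1 _ run2.
Qed.

(** [x i] is the state before round [i], and one bound [t] serves states, tests and bodies. A round
    reads the state, tests it and runs the body, whence the factor 3; the extra round is the final
    test. *)
Lemma computes_while C P (x : nat -> data) n t :
  (forall i, i <= n -> dsize (x i) <= t) ->
  (forall i, i < n -> exists2 v, v <> Leaf & computes C t (x i) v) ->
  computes C t (x n) Leaf ->
  (forall i, i < n -> computes P t (x i) (x i.+1)) ->
  computes (pWhile C P) (3 * t * n.+1) (x 0) (x n).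
Proof.
elim: n x => [|n IHn] x size_x runC [k le_k stopC] runP.
  exists (dsize (x 0) + k); first by have := size_x 0 isT; lia.
  by rewrite ticksD; apply: ExecWhileDone.
have [k3 le3 run3] : computes (pWhile C P) (3 * t * n.+1) (x 1) (x n.+1).
  apply: (IHn (fun i => x i.+1)) => [i lt_i|i lt_i||i lt_i].
  - exact: size_x.
  - exact: runC.
  - by exists k.
  - exact: runP.
have [v vP [k1 le1 run1]] := runC 0 isT; have [k2 le2 run2] := runP 0 isT.
exists (dsize (x 0) + (k1 + (k2 + k3))); first by have := size_x 0 isT; lia.
by rewrite !ticksD; apply: ExecWhileLoop run1 vP run2 run3.
Qed.

(** * Polynomial-time functions between encoded types *)

Section PTime.

(** The domain [D] is there for the functions of a decomposition method, whose time bounds are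
    granted on legitimate arguments. The time is a polynomially bounded function of the object
    rather than a polynomial in its size, so that it can be stated through sizes of auxiliary
    objects. *)
Definition ptime_on G U `{encoding G} `{encoding U} (D : G -> Prop) (f : G -> U) :=
  exists P (t : G -> nat), pbounded t /\
  forall x, D x -> computes P (t x) (enc x) (enc (f x)).

Definition ptime G U `{encoding G} `{encoding U} (f : G -> U) :=
  ptime_on (fun=> True) f.

Lemma polytime_on G U {eG : encoding G} {eU : encoding U} D (f : G -> U) :
  polytime enc enc D f -> ptime_on D f.
Proof.
move=> [P [p run]]; exists P, (fun x => p.[esize x]%R); split; first by exists p.
by move=> x /run.
Qed.

Lemma ptime_onE G U {eG : encoding G} {eU : encoding U} D (f g : G -> U) :
  (forall x, D x -> f x = g x) -> ptime_on D f -> ptime_on D g.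
Proof.
by move=> eqfg [P [t [bt run]]]; exists P, t; split=> // x Dx; rewrite -eqfg //; apply: run.
Qed.

Lemma ptime_ext G U {eG : encoding G} {eU : encoding U} (f g : G -> U) :
  f =1 g -> ptime f -> ptime g.
Proof. by move=> eqfg; apply: ptime_onE. Qed.

Lemma ptime_onW G U {eG : encoding G} {eU : encoding U} D (f : G -> U) :
  ptime f -> ptime_on D f.
Proof. by case=> P [t [bt run]]; exists P, t; split=> // x _; apply: run. Qed.

Lemma ptime_on_comp G T U {eG : encoding G} {eT : encoding T} {eU : encoding U} D D'
    (f : G -> T) (h : T -> U) :
  (forall x, D x -> D' (f x)) -> ptime_on D f -> ptime_on D' h ->
  ptime_on D (fun x => h (f x)).
Proof.
move=> sub [P [t [bt run]]] [Q [u [[q bu] runQ]]].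
exists (pSeq P Q), (fun x => esize x + (t x + q.[t x]%R)); split.
  by apply: pboundedD pbounded_size (pboundedD bt (pbounded_horner q bt)).
move=> x Dx; apply: computes_seq (run x Dx) _; apply: computes_le (runQ _ (sub x Dx)).
by apply: leq_trans (bu _) _; apply: leq_horner; apply: computes_size (run x Dx).
Qed.

Lemma ptime_on_pair G T U {eG : encoding G} {eT : encoding T} {eU : encoding U} D
    (f : G -> T) (h : G -> U) :
  ptime_on D f -> ptime_on D h -> ptime_on D (fun x => (f x, h x)).
Proof.
move=> [P [t [bt run]]] [Q [u [bu runQ]]].
exists (pPair P Q), (fun x => esize x + (t x + u x)); split.
  by apply: pboundedD pbounded_size (pboundedD bt bu).
by move=> x Dx; apply: computes_pair; [apply: run | apply: runQ].
Qed.

Lemma ptime_comp G T U {eG : encoding G} {eT : encoding T} {eU : encoding U}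
    (h : T -> U) (f : G -> T) :
  ptime h -> ptime f -> ptime (fun x => h (f x)).
Proof. by move=> ptf pth; apply: ptime_on_comp pth ptf. Qed.

Lemma pbounded_esize G U {eG : encoding G} {eU : encoding U} (f : G -> U) :
  ptime f -> pbounded (fun x => esize (f x)).
Proof.
move=> [P [t [bt run]]]; apply: pbounded_le bt => x.
by apply: computes_size (run x I).
Qed.

Context (G : Type) {eG : encoding G}.

Lemma ptime_id : ptime (fun x : G => x).
Proof.
exists pId, (@esize G eG); split; first exact: pbounded_size.
by move=> x _; exists (esize x) => //; apply: ExecId.
Qed.

Lemma ptime_const U {eU : encoding U} (u : U) : ptime (fun _ : G => u).
Proof.
exists (pConst (enc u)), (fun x => esize x + esize u); split.
  exact: pboundedD pbounded_size (pbounded_const _).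
by move=> x _; exists (esize x + esize u) => //; apply: ExecConst.
Qed.

Lemma ptime_pair T U {eT : encoding T} {eU : encoding U} (f : G -> T) (h : G -> U) :
  ptime f -> ptime h -> ptime (fun x => (f x, h x)).
Proof. exact: ptime_on_pair. Qed.

Lemma ptime_dhead T U {eT : encoding T} {eU : encoding U} (h : T -> U) (f : G -> T) :
  (forall x, enc (h x) = dhead (enc x)) -> ptime f -> ptime (fun x => h (f x)).
Proof.
move=> eq_h; apply: ptime_comp.
exists pHead, (@esize T eT); split; first exact: pbounded_size.
by move=> x _; exists (esize x) => //; rewrite eq_h; apply: ExecHead.
Qed.

Lemma ptime_dtail T U {eT : encoding T} {eU : encoding U} (h : T -> U) (f : G -> T) :
  (forall x, enc (h x) = dtail (enc x)) -> ptime f -> ptime (fun x => h (f x)).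
Proof.
move=> eq_h; apply: ptime_comp.
exists pTail, (@esize T eT); split; first exact: pbounded_size.
by move=> x _; exists (esize x) => //; rewrite eq_h; apply: ExecTail.
Qed.

(** A change of type that keeps the code costs nothing. Constructors arise in this way from pairs,
    as projections do from [pHead] and [pTail]. *)
Lemma ptime_recode T U {eT : encoding T} {eU : encoding U} (h : T -> U) (f : G -> T) :
  (forall x, enc (h x) = enc x) -> ptime f -> ptime (fun x => h (f x)).
Proof.
move=> eq_h [P [t [bt run]]]; exists P, t; split=> // x _.
by rewrite eq_h; apply: run.
Qed.

Lemma ptime_fst T U {eT : encoding T} {eU : encoding U} (f : G -> T * U) :
  ptime f -> ptime (fun x => (f x).1).
Proof. exact: ptime_dhead. Qed.

Lemma ptime_snd T U {eT : encoding T} {eU : encoding U} (f : G -> T * U) :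
  ptime f -> ptime (fun x => (f x).2).
Proof. exact: ptime_dtail. Qed.

Lemma ptime_cons T {eT : encoding T} (f : G -> T) (s : G -> seq T) :
  ptime f -> ptime s -> ptime (fun x => f x :: s x).
Proof.
move=> ptf pts; apply: (ptime_recode (h := fun y : T * seq T => y.1 :: y.2)
    (f := fun x => (f x, s x))) => //.
exact: ptime_pair.
Qed.

Lemma ptime_behead T {eT : encoding T} (s : G -> seq T) :
  ptime s -> ptime (fun x => behead (s x)).
Proof. by apply: ptime_dtail; case. Qed.

Lemma ptime_if U {eU : encoding U} (c : G -> bool) (f h : G -> U) :
  ptime c -> ptime f -> ptime h -> ptime (fun x => if c x then f x else h x).
Proof.
move=> [C [t1 [b1 run1]]] [P [t2 [b2 run2]]] [Q [t3 [b3 run3]]].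
exists (pIf C P Q), (fun x => esize x + (t1 x + (t2 x + t3 x))); split.
  exact: pboundedD pbounded_size (pboundedD b1 (pboundedD b2 b3)).
move=> x _; apply: computes_if; first exact: run1.
by case: (c x) => /=; [apply: computes_le (run2 x I) | apply: computes_le (run3 x I)];
  lia.
Qed.

Lemma ptime_nilp T {eT : encoding T} (s : G -> seq T) :
  ptime s -> ptime (fun x => nilp (s x)).
Proof.
apply: (ptime_comp (h := fun t : seq T => nilp t)).
exists (pIf pId (pConst Leaf) (pConst dtrue)), (fun t => esize t + (esize t + (esize t + 3))).
split.
  apply: pboundedD pbounded_size (pboundedD pbounded_size _).
  exact: pboundedD pbounded_size (pbounded_const _).
move=> t _; apply: computes_if; first exact: computes_id.
case: t => [|x t] /=; first exact: computes_const.
by apply: computes_le (computes_const _ _); rewrite /esize /=; lia.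
Qed.

Lemma ptime_while T U {eT : encoding T} {eU : encoding U} (init : G -> T) (res : G -> U)
    (C P : prog) (x : G -> nat -> data) (N t : G -> nat) :
  ptime init -> pbounded N -> pbounded t ->
  (forall g, x g 0 = enc (init g)) -> (forall g, x g (N g) = enc (res g)) ->
  (forall g i, i <= N g -> dsize (x g i) <= t g) ->
  (forall g i, i < N g -> exists2 v, v <> Leaf & computes C (t g) (x g i) v) ->
  (forall g, computes C (t g) (x g (N g)) Leaf) ->
  (forall g i, i < N g -> computes P (t g) (x g i) (x g i.+1)) ->
  ptime res.
Proof.
move=> [Q [u [bu run]]] bN bt x0 xN size_x runC stopC runP.
exists (pSeq Q (pWhile C P)), (fun g => esize g + (u g + 3 * t g * (N g).+1)); split.
  apply: pboundedD pbounded_size (pboundedD bu (pboundedM _ (pboundedS bN))).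
  exact: pboundedM (pbounded_const _) bt.
move=> g _; apply: computes_seq (run g I) _; rewrite -x0 -xN.
by apply: computes_while; [apply: size_x | apply: runC | apply: stopC | apply: runP].
Qed.

(** Polynomial-time steps alone would not do: a step that doubles its accumulator makes it
    exponential. Hence the bound [b] on the accumulator after every prefix of the list. *)
Lemma ptime_foldl T U {eT : encoding T} {eU : encoding U}
    (F : G -> U -> T -> U) (z : G -> U) (l : G -> seq T) (b : G -> nat) :
  ptime (fun y : G * U * T => F y.1.1 y.1.2 y.2) -> ptime z -> ptime l ->
  pbounded b ->
  (forall g s1 s2, l g = s1 ++ s2 -> esize (foldl (F g) (z g) s1) <= b g) ->
  ptime (fun g => foldl (F g) (z g) (l g)).
Proof.
move=> [P [tF [[pF bF] runF]]] ptz ptl bb le_b.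
(* the loop runs through the pairs ((g, accumulator), remaining elements) *)
pose (x := fun g i => enc ((g, foldl (F g) (z g) (take i (l g))), drop i (l g))).
pose (S := fun g => esize g + b g + esize (l g) + 2).
have bS: pbounded S.
  apply: pboundedD (pbounded_const _); apply: pboundedD (pbounded_esize ptl).
  exact: pboundedD pbounded_size bb.
have size_x g i : dsize (x g i) <= S g.
  have := le_b g (take i (l g)) (drop i (l g)) (esym (cat_take_drop _ _)).
  have := @esize_catl T eT (take i (l g)) (drop i (l g)); rewrite cat_take_drop.
  have: 0 < esize (take i (l g)) by exact: esize_gt0.
  rewrite -[dsize (x g i)]/(esize ((g, _), _)) !esize_pair /S; lia.
(* [arg] turns the state [((g, u), a :: s)] into [((g, u), a)], the argument of [P], and [body]
   turns it into the next state. The test [pTail] returns the remaining list, whose code is [Leaf]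
   exactly when it is empty. *)
pose arg := pPair pHead (pSeq pTail pHead).
pose body := pPair (pPair (pSeq pHead pHead) (pSeq arg P)) (pSeq pTail pTail).
pose t : G -> nat := fun g => 30 * S g + pF.[S g]%R.
have bt: pbounded t.
  apply: pboundedD (pbounded_horner pF bS); exact: pboundedM (pbounded_const _) bS.
have pt: ptime (fun g => ((g, foldl (F g) (z g) (l g)), Nil T)); last first.
  exact (ptime_snd (ptime_fst pt)).
apply: (@ptime_while _ _ _ _ (fun g => ((g, z g), l g)) _ pTail body x
  (fun g => size (l g)) t) => //.
- by apply: ptime_pair => //; apply: ptime_pair => //; apply: ptime_id.
- by apply: pbounded_le (pbounded_esize ptl) => g; apply: ltnW (size_esize _).
- by move=> g; rewrite /x take0 drop0.
- by move=> g; rewrite /x take_size drop_size.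
- by move=> g i _; apply: leq_trans (size_x g i) _; rewrite /t; lia.
- move=> g i lt_i; exists (enc (drop i (l g))).
    by move: lt_i; rewrite -subn_gt0 -size_drop; case: (drop i (l g)).
  apply: computes_le (computes_tail _).
  by apply: leq_trans (size_x g i) _; rewrite /t; lia.
- move=> g; rewrite [X in computes _ _ _ X](_ : _ = dtail (x g (size (l g)))).
    apply: computes_le (computes_tail _).
    by apply: leq_trans (size_x g (size (l g))) _; rewrite /t; lia.
  by rewrite /x drop_size.
move=> g i lt_i.
case Ei: (drop i (l g)) => [|a s]; first by move: lt_i; rewrite -subn_gt0 -size_drop Ei.
have Ei1: drop i.+1 (l g) = s by rewrite -add1n -drop_drop Ei /= drop0.
have Ti1: take i.+1 (l g) = rcons (take i (l g)) a.
  by rewrite (take_nth a lt_i); congr rcons; rewrite -[X in nth _ _ X]addn0 -nth_drop Ei.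
have eqx: x g i = Node (Node (enc g) (enc (foldl (F g) (z g) (take i (l g)))))
    (Node (enc a) (enc s)) by rewrite /x Ei.
have := size_x g i; have := size_x g i.+1.
have := runF ((g, foldl (F g) (z g) (take i (l g))), a) I.
rewrite /x Ei1 Ti1 foldl_rcons /= -/(x g i) eqx; set u := foldl _ _ _.
set w := F g u a => runw size_x1 size_xi. rewrite Ei /= in size_xi.
have le_tF: tF (g, u, a) <= pF.[S g]%R.
  apply: leq_trans (bF _) (leq_horner _ _).
  by move: size_xi; rewrite /esize /= /enc_pair /=; lia.
apply: computes_le; last first.
  apply: computes_pair; last first.
    by apply: computes_seq; [apply: computes_tail | apply: computes_tail].
  apply: computes_pair.
    by apply: computes_seq; [apply: computes_head | apply: computes_head].
  apply: computes_seq; last exact: runw.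
  apply: computes_pair; first exact: computes_head.
  by apply: computes_seq; [apply: computes_tail | apply: computes_head].
move: size_xi le_tF; rewrite /t /esize /= /enc_pair /=; lia.
Qed.
End PTime.

(** * Folds and list functions in polynomial time *)

Lemma pbounded_elements G {eG : encoding G} T {eT : encoding T} (l : G -> seq T)
    (c : G * T -> nat) :
  ptime l -> pbounded c ->
  exists2 b : G -> nat, pbounded b &
  forall g s1 x s2, l g = s1 ++ x :: s2 -> c (g, x) <= b g.
Proof.
move=> ptl [p le_c]; exists (fun g => p.[esize g + esize (l g)]%R).
  apply: pbounded_horner; apply: pboundedD (pbounded_esize ptl).
  exact: pbounded_size.
move=> g s1 x s2 eq_l; apply: leq_trans (le_c _) (leq_horner _ _).
have := @esize_catl T eT s1 (x :: s2); rewrite -eq_l esize_cons esize_pair.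
have: 0 < esize s1 by exact: esize_gt0.
have: 0 < esize s2 by exact: esize_gt0.
lia.
Qed.

(** A growth that depends on the element but not on the accumulator adds up along the list, so only
    a single step has to be examined. *)
Lemma ptime_foldl_growth G {eG : encoding G} T U {eT : encoding T} {eU : encoding U}
    (F : G -> U -> T -> U) (z : G -> U) (l : G -> seq T) (c : G * T -> nat) :
  ptime (fun y : G * U * T => F y.1.1 y.1.2 y.2) -> ptime z -> ptime l ->
  pbounded c -> (forall g u x, esize (F g u x) <= esize u + c (g, x)) ->
  ptime (fun g => foldl (F g) (z g) (l g)).
Proof.
move=> ptF ptz ptl bc le_F; have [b bb le_b] := pbounded_elements ptl bc.
apply: (@ptime_foldl G eG T U eT eU F z l
  (fun g => esize (z g) + esize (l g) * b g)) => //.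
  exact: pboundedD (pbounded_esize ptz) (pboundedM (pbounded_esize ptl) bb).
move=> g s1 s2 eq_l; have le_s1: size s1 <= esize (l g).
  apply: leq_trans (ltnW (size_esize _)).
  by rewrite eq_l size_cat leq_addr.
apply: (@leq_trans (esize (z g) + size s1 * b g)); last by rewrite leq_add2l leq_mul2r le_s1 orbT.
elim/last_ind: s1 s2 eq_l {le_s1} => [|s1 x IHs] s2 eq_l; first by rewrite addn0.
rewrite -cats1 foldl_cat /= size_cat addn1 mulSn addnCA addnC.
apply: leq_trans (le_F _ _ _) _; rewrite cat_rcons in eq_l.
exact: leq_add (IHs _ eq_l) (le_b _ _ _ _ eq_l).
Qed.

Lemma ptime_size G {eG : encoding G} T {eT : encoding T} (s : G -> seq T) :
  ptime s -> ptime (fun x => size (s x)).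
Proof.
move=> pts.
have pt: ptime (fun g => foldl (fun n _ => n.+1) 0 (s g)).
  apply: (ptime_foldl_growth (F := fun=> fun n _ => n.+1) (z := fun=> 0) (c := fun=> 2)) => //.
  - apply: (ptime_recode (h := fun y : unit * nat => y.2.+1) (f := fun x => (tt, x.1.2))) => //.
    by apply: ptime_pair; [apply: ptime_const | apply: ptime_snd; apply: ptime_fst; apply: ptime_id].
  - exact: ptime_const.
  - exact: pbounded_const.
  - by move=> g u x; rewrite !esize_nat; lia.
apply: ptime_ext pt => g; elim/last_ind: (s g) => // t x IHt.
by rewrite foldl_rcons size_rcons IHt.
Qed.

Lemma ptime_catrev G {eG : encoding G} T {eT : encoding T} (s t : G -> seq T) :
  ptime s -> ptime t -> ptime (fun x => catrev (s x) (t x)).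
Proof.
move=> pts ptt.
have pt: ptime (fun g => foldl (fun u x => x :: u) (t g) (s g)).
  apply: (ptime_foldl_growth (F := fun=> fun u x => x :: u) (c := fun y => (esize y.2).+1)) => //.
  - apply: ptime_cons; first by apply: ptime_snd; apply: ptime_id.
    by apply: ptime_snd; apply: ptime_fst; apply: ptime_id.
  - apply: pboundedS; apply: pbounded_esize; apply: ptime_snd; exact: ptime_id.
  - by move=> g u x; rewrite esize_cons /=; lia.
by apply: ptime_ext pt => g; elim: (s g) (t g) => //= x l IHl u; rewrite IHl.
Qed.

Lemma ptime_rev G {eG : encoding G} T {eT : encoding T} (s : G -> seq T) :
  ptime s -> ptime (fun x => rev (s x)).
Proof. by move=> pts; apply: ptime_catrev => //; apply: ptime_const. Qed.

Lemma ptime_cat G {eG : encoding G} T {eT : encoding T} (s t : G -> seq T) :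
  ptime s -> ptime t -> ptime (fun x => s x ++ t x).
Proof.
move=> pts ptt; apply: (@ptime_ext _ _ _ _ (fun x => catrev (rev (s x)) (t x))).
  by move=> x; rewrite catrevE revK.
by apply: ptime_catrev => //; apply: ptime_rev.
Qed.

Lemma ptime_foldr_growth G {eG : encoding G} T U {eT : encoding T} {eU : encoding U}
    (F : G -> T -> U -> U) (z : G -> U) (l : G -> seq T) (c : G * T -> nat) :
  ptime (fun y : G * U * T => F y.1.1 y.2 y.1.2) -> ptime z -> ptime l ->
  pbounded c -> (forall g u x, esize (F g x u) <= esize u + c (g, x)) ->
  ptime (fun g => foldr (F g) (z g) (l g)).
Proof.
move=> ptF ptz ptl bc le_F.
apply: (@ptime_ext _ _ _ _ (fun g => foldl (fun u x => F g x u) (z g) (rev (l g)))).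
  by move=> g; rewrite foldl_rev.
apply: (ptime_foldl_growth (F := fun g u x => F g x u)) bc _ => //.
exact: ptime_rev.
Qed.

Lemma ptime_map G {eG : encoding G} T U {eT : encoding T} {eU : encoding U}
    (F : G -> T -> U) (l : G -> seq T) :
  ptime (fun y : G * T => F y.1 y.2) -> ptime l -> ptime (fun g => map (F g) (l g)).
Proof.
move=> ptF ptl.
apply: (ptime_foldr_growth (F := fun g x u => F g x :: u) (z := fun=> [::])
  (c := fun y => (esize (F y.1 y.2)).+1)) => //.
- apply: ptime_cons.
    apply: (ptime_comp (h := fun y : G * T => F y.1 y.2) (f := fun y => (y.1.1, y.2))) => //.
    apply: ptime_pair; first by apply: ptime_fst; apply: ptime_fst; apply: ptime_id.
    by apply: ptime_snd; apply: ptime_id.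
  by apply: ptime_snd; apply: ptime_fst; apply: ptime_id.
- exact: ptime_const.
- by apply: pboundedS; apply: pbounded_esize.
- by move=> g u x; rewrite esize_cons /=; lia.
Qed.

Lemma ptime_filter G {eG : encoding G} T {eT : encoding T} (a : G -> T -> bool)
    (l : G -> seq T) :
  ptime (fun y : G * T => a y.1 y.2) -> ptime l -> ptime (fun g => filter (a g) (l g)).
Proof.
move=> pta ptl.
apply: (ptime_foldr_growth (F := fun g x u => if a g x then x :: u else u)
  (z := fun=> [::]) (c := fun y => (esize y.2).+1)) => //.
- apply: ptime_if; last by apply: ptime_snd; apply: ptime_fst; apply: ptime_id.
    apply: (ptime_comp (h := fun y : G * T => a y.1 y.2) (f := fun y => (y.1.1, y.2))) => //.
    apply: ptime_pair; first by apply: ptime_fst; apply: ptime_fst; apply: ptime_id.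
    by apply: ptime_snd; apply: ptime_id.
  apply: ptime_cons; first by apply: ptime_snd; apply: ptime_id.
  by apply: ptime_snd; apply: ptime_fst; apply: ptime_id.
- exact: ptime_const.
- by apply: pboundedS; apply: pbounded_esize; apply: ptime_snd; apply: ptime_id.
- by move=> g u x; case: ifP => _; rewrite ?esize_cons /=; lia.
Qed.

Lemma ptime_negb G {eG : encoding G} (b : G -> bool) :
  ptime b -> ptime (fun x => ~~ b x).
Proof. by move=> ptb; apply: ptime_if => //; apply: ptime_const. Qed.

Lemma ptime_implb G {eG : encoding G} (b c : G -> bool) :
  ptime b -> ptime c -> ptime (fun x => b x ==> c x).
Proof. by move=> ptb ptc; apply: ptime_if => //; apply: ptime_const. Qed.

Lemma ptime_has G {eG : encoding G} T {eT : encoding T} (a : G -> T -> bool)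
    (l : G -> seq T) :
  ptime (fun y : G * T => a y.1 y.2) -> ptime l -> ptime (fun g => has (a g) (l g)).
Proof.
move=> pta ptl; apply: (@ptime_ext _ _ _ _ (fun g => ~~ nilp (filter (a g) (l g)))).
  by move=> g; rewrite has_count -size_filter; case: filter.
by apply: ptime_negb; apply: ptime_nilp; apply: ptime_filter.
Qed.

Lemma ptime_all G {eG : encoding G} T {eT : encoding T} (a : G -> T -> bool)
    (l : G -> seq T) :
  ptime (fun y : G * T => a y.1 y.2) -> ptime l -> ptime (fun g => all (a g) (l g)).
Proof.
move=> pta ptl; apply: (@ptime_ext _ _ _ _ (fun g => ~~ has (fun x => ~~ a g x) (l g))).
  by move=> g; rewrite has_predC negbK.
by apply: ptime_negb; apply: ptime_has => //; exact: (ptime_negb pta).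
Qed.

Lemma ptime_flatten G {eG : encoding G} T {eT : encoding T} (l : G -> seq (seq T)) :
  ptime l -> ptime (fun g => flatten (l g)).
Proof.
move=> ptl; apply: (ptime_foldr_growth (F := fun (_ : G) (x u : seq T) => x ++ u) (z := fun=> [::])
  (c := fun y : G * seq T => esize y.2)) => //.
- apply: ptime_cat; first by apply: ptime_snd; apply: ptime_id.
  by apply: ptime_snd; apply: ptime_fst; apply: ptime_id.
- exact: ptime_const.
- by apply: pbounded_esize; apply: ptime_snd; apply: ptime_id.
- by move=> g u x; have := @esize_catl T eT x u; rewrite /=; lia.
Qed.

Lemma ptime_head G {eG : encoding G} (x0 : data) (s : G -> seq data) :
  ptime s -> ptime (fun x => head x0 (s x)).
Proof.
move=> pts; apply: (@ptime_ext _ _ _ _ (fun x => if nilp (s x) then x0 else dhead (enc (s x)))).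
  by move=> x; case: (s x).
apply: ptime_if; [exact: ptime_nilp | exact: ptime_const |].
by apply: (ptime_dhead (h := fun t : seq data => dhead (enc t))) pts.
Qed.

Lemma ptime_head_seq G {eG : encoding G} (s : G -> seq (seq data)) :
  ptime s -> ptime (fun x => head [::] (s x)).
Proof. by apply: ptime_dhead; case. Qed.

(** Numbers are unary: [k] and a list of [k] units have the same code. So a counting loop is a fold
    over a list. *)
Lemma ptime_nseq G {eG : encoding G} (n : G -> nat) :
  ptime n -> ptime (fun x => nseq (n x) tt).
Proof. by apply: ptime_recode => k; rewrite /enc /enc_seq map_nseq. Qed.

Lemma ptime_iter G {eG : encoding G} U {eU : encoding U} (F : G -> U -> U)
    (n : G -> nat) (z : G -> U) :
  ptime (fun y : G * U => F y.1 y.2) -> ptime n -> ptime z ->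
  (forall g u, esize (F g u) <= esize u) ->
  ptime (fun g => iter (n g) (F g) (z g)).
Proof.
move=> ptF ptn ptz le_F.
apply: (@ptime_ext _ _ _ _ (fun g => foldr (fun _ u => F g u) (z g) (nseq (n g) tt))).
  by move=> g; elim: (n g) => //= k ->.
apply: (ptime_foldr_growth (F := fun g _ u => F g u) (c := fun=> 0)) => //.
- apply: (ptime_comp (h := fun y : G * U => F y.1 y.2) (f := fun y => y.1)) => //.
  by apply: ptime_fst; apply: ptime_id.
- exact: ptime_nseq.
- exact: pbounded_const.
- by move=> g u x; rewrite addn0.
Qed.

Lemma ptime_drop G {eG : encoding G} T {eT : encoding T} (n : G -> nat)
    (s : G -> seq T) :
  ptime n -> ptime s -> ptime (fun g => drop (n g) (s g)).
Proof.
move=> ptn pts; apply: (@ptime_ext _ _ _ _ (fun g => iter (n g) behead (s g))).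
  move=> g; elim: (n g) => [|k IHk]; first by rewrite drop0.
  by rewrite iterS IHk -drop1 drop_drop add1n.
apply: (ptime_iter (F := fun=> behead)) => //.
  by apply: ptime_behead; apply: ptime_snd; apply: ptime_id.
by move=> g [|x t] //=; rewrite esize_cons; lia.
Qed.

Lemma nth_head_drop T (x0 : T) s n : nth x0 s n = head x0 (drop n s).
Proof. by rewrite -nth0 nth_drop addn0. Qed.

Lemma ptime_nth G {eG : encoding G} (s : G -> seq data) (n : G -> nat) :
  ptime s -> ptime n -> ptime (fun g => nth Leaf (s g) (n g)).
Proof.
move=> pts ptn; apply: (@ptime_ext _ _ _ _ (fun g => head Leaf (drop (n g) (s g)))).
  by move=> g; rewrite nth_head_drop.
by apply: ptime_head; apply: ptime_drop.
Qed.

Lemma ptime_nth_seq G {eG : encoding G} (s : G -> seq (seq data)) (n : G -> nat) :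
  ptime s -> ptime n -> ptime (fun g => nth [::] (s g) (n g)).
Proof.
move=> pts ptn; apply: (@ptime_ext _ _ _ _ (fun g => head [::] (drop (n g) (s g)))).
  by move=> g; rewrite nth_head_drop.
by apply: ptime_head_seq; apply: ptime_drop.
Qed.

Lemma ptime_nth_nat G {eG : encoding G} (s : G -> seq nat) (n : G -> nat) :
  ptime s -> ptime n -> ptime (fun g => nth 0 (s g) (n g)).
Proof.
move=> pts ptn; apply: (@ptime_ext _ _ _ _ (fun g => head 0 (drop (n g) (s g)))).
  by move=> g; rewrite nth_head_drop.
by apply: (ptime_dhead (h := head 0)); [case | apply: ptime_drop].
Qed.

Lemma ptime_sumn G {eG : encoding G} (s : G -> seq nat) :
  ptime s -> ptime (fun g => sumn (s g)).
Proof.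
move=> pts; apply: (@ptime_ext _ _ _ _ (fun g => size (flatten [seq nseq n tt | n <- s g]))).
  by move=> g; rewrite size_flatten /shape -map_comp; congr sumn; apply: map_id_in => n _ /=;
     rewrite size_nseq.
apply: ptime_size; apply: ptime_flatten; apply: (ptime_map (F := fun=> nseq^~ tt)) => //.
by apply: ptime_nseq; apply: ptime_snd; apply: ptime_id.
Qed.

Lemma ptime_iota G {eG : encoding G} (n : G -> nat) :
  ptime n -> ptime (fun g => iota 0 (n g)).
Proof.
move=> ptn.
have eq_iota s : iota 0 (size s) = foldl (fun t (_ : unit) => rcons t (size t)) [::] s.
  elim/last_ind: s => // s x IHs.
  by rewrite foldl_rcons -IHs size_rcons -addn1 iotaD -cats1 size_iota.
apply: (@ptime_ext _ _ _ _ (fun g => foldl (fun t _ => rcons t (size t)) [::] (nseq (n g) tt))).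
  by move=> g; rewrite -eq_iota size_nseq.
apply: (ptime_foldl (F := fun _ t _ => rcons t (size t)) (z := fun=> [::])
  (b := fun g => esize (n g) * esize (n g) + 1)) => //.
- apply: (@ptime_ext _ _ _ _ (fun y => y.1.2 ++ [:: size y.1.2])).
    by move=> y; rewrite cats1.
  have pt: ptime (fun y : G * seq nat * unit => y.1.2).
    by apply: ptime_snd; apply: ptime_fst; apply: ptime_id.
  apply: ptime_cat => //; apply: ptime_cons; last exact: ptime_const.
  exact: ptime_size.
- exact: ptime_const.
- exact: ptime_nseq.
- apply: pboundedD (pbounded_const _).
  by apply: pboundedM; apply: pbounded_esize.
move=> g s1 s2 eq_n; rewrite -eq_iota esize_nat.
have {eq_n}: size s1 <= n g by rewrite -(size_nseq (n g) tt) eq_n size_cat leq_addr.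
move=> le_n; apply: (@leq_trans (size s1 * ((n g).*2 + 3) + 1)); last by nia.
elim: (size s1) le_n => [|k IHk] le_k; first by rewrite esize_nil.
rewrite (_ : iota 0 k.+1 = iota 0 k ++ [:: k]); last by rewrite -[k.+1]addn1 iotaD.
have := @esize_catl nat enc_nat (iota 0 k) [:: k].
by have := IHk (ltnW le_k); rewrite esize_cons esize_nil esize_nat; nia.
Qed.

Lemma ptime_eq G {eG : encoding G} (T : eqType) {eT : encoding T} (f h : G -> T) :
  injective (@enc T eT) -> ptime f -> ptime h -> ptime (fun g => f g == h g).
Proof.
move=> inj ptf pth.
apply: (ptime_comp (h := fun y : T * T => y.1 == y.2) (f := fun g => (f g, h g))); last exact: ptime_pair.
exists pEq, (@esize _ _); split; first exact: pbounded_size.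
move=> y _; rewrite (_ : enc (_ == _) = deq (enc y)); first exact: computes_eq.
by rewrite /= (inj_eq inj); case: eqP.
Qed.

Lemma ptime_mem G {eG : encoding G} (T : eqType) {eT : encoding T} (f : G -> T)
    (s : G -> seq T) :
  injective (@enc T eT) -> ptime f -> ptime s -> ptime (fun g => f g \in s g).
Proof.
move=> inj ptf pts; apply: (@ptime_ext _ _ _ _ (fun g => has (fun x => f g == x) (s g))).
  by move=> g; rewrite -has_pred1; apply: eq_has => x /=; rewrite eq_sym.
apply: ptime_has => //; apply: ptime_eq => //; last by apply: ptime_snd; apply: ptime_id.
by apply: ptime_comp ptf _; apply: ptime_fst; apply: ptime_id.
Qed.

(** * The algorithm's operations on structures run in polynomial time *)

(** Turns relations into an [eqType], so that a relation can be a member of [rels A]. *)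
Definition rel_triple (S : eqType) (r : relation S) := (rsym r, rar r, rtup r).
Definition triple_rel (S : eqType) (x : S * nat * seq (seq data)) := Rel x.1.1 x.1.2 x.2.
Lemma rel_tripleK (S : eqType) : cancel (@rel_triple S) (@triple_rel S).
Proof. by case. Qed.
HB.instance Definition _ (S : eqType) :=
  Equality.copy (relation S) (can_type (@rel_tripleK S)).

Lemma of_seq_inj : injective of_seq.
Proof. by elim=> [|x s IHs] [|y t] //= [-> /IHs->]. Qed.

#[global] Instance enc_sym : encoding sym := of_sym.
#[global] Instance enc_vsym : encoding vsym := of_vsym.
#[global] Instance enc_rel (S : eqType) `{encoding S} : encoding (relation S) :=
  fun r => enc (rsym r, (rar r, rtup r)).
#[global] Instance enc_str (S : eqType) `{encoding S} : encoding (structure S) :=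
  fun A => enc (univ A, rels A).

Lemma enc_seq_data (s : seq data) : enc s = of_seq s.
Proof. by rewrite /enc /enc_seq map_id. Qed.

Lemma enc_strE (S : eqType) {eS : encoding S} (A : structure S) :
  enc A = of_str enc A.
Proof.
rewrite /of_str -enc_seq_data; congr Node; congr of_seq; apply: eq_map => r.
congr (Node _ (Node _ (of_seq _))); apply: eq_map => t; exact: enc_seq_data.
Qed.

Lemma enc_sym_inj : injective (@enc sym enc_sym).
Proof. by case=> d [] d' [] // ->. Qed.

Lemma enc_vsym_inj : injective (@enc vsym enc_vsym).
Proof. by case=> [R t|d] [R' t'|d'] //= [] => [/enc_sym_inj-> /of_seq_inj->|->]. Qed.

Lemma enc_data_inj : injective (@enc data enc_data).
Proof. by []. Qed.

Lemma ptime_rsym G {eG : encoding G} (S : eqType) {eS : encoding S}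
    (r : G -> relation S) :
  ptime r -> ptime (fun x => rsym (r x)).
Proof. exact: ptime_dhead. Qed.

Lemma ptime_rar_rtup G {eG : encoding G} (S : eqType) {eS : encoding S}
    (r : G -> relation S) :
  ptime r -> ptime (fun x => (rar (r x), rtup (r x))).
Proof. by apply: (ptime_dtail (h := fun r : relation S => (rar r, rtup r))). Qed.

Lemma ptime_rar G {eG : encoding G} (S : eqType) {eS : encoding S}
    (r : G -> relation S) :
  ptime r -> ptime (fun x => rar (r x)).
Proof. by move=> /ptime_rar_rtup ptr; exact: (ptime_fst ptr). Qed.

Lemma ptime_rtup G {eG : encoding G} (S : eqType) {eS : encoding S}
    (r : G -> relation S) :
  ptime r -> ptime (fun x => rtup (r x)).
Proof. by move=> /ptime_rar_rtup ptr; exact: (ptime_snd ptr). Qed.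

Lemma ptime_Rel G {eG : encoding G} (S : eqType) {eS : encoding S} (R : G -> S) n ts :
  ptime R -> ptime n -> ptime ts -> ptime (fun x => Rel (R x) (n x) (ts x)).
Proof.
move=> ptR ptn ptts.
apply: (ptime_recode (h := fun y : S * (nat * seq (seq data)) => Rel y.1 y.2.1 y.2.2)
  (f := fun x => (R x, (n x, ts x)))) => //.
by apply: ptime_pair => //; apply: ptime_pair.
Qed.

Lemma ptime_univ G {eG : encoding G} (S : eqType) {eS : encoding S}
    (A : G -> structure S) :
  ptime A -> ptime (fun x => univ (A x)).
Proof. exact: ptime_dhead. Qed.

Lemma ptime_rels G {eG : encoding G} (S : eqType) {eS : encoding S}
    (A : G -> structure S) :
  ptime A -> ptime (fun x => rels (A x)).
Proof. exact: ptime_dtail. Qed.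

Lemma ptime_Str G {eG : encoding G} (S : eqType) {eS : encoding S} U (rs : G -> seq
    (relation S)) :
  ptime U -> ptime rs -> ptime (fun x => Str (U x) (rs x)).
Proof.
move=> ptU ptrs.
apply: (ptime_recode (h := fun y : seq data * seq (relation S) => Str y.1 y.2)
  (f := fun x => (U x, rs x))) => //.
exact: ptime_pair.
Qed.

Lemma ptime_Dom G {eG : encoding G} (X : G -> data) :
  ptime X -> ptime (fun x => Dom (X x)).
Proof.
move=> ptX; apply: (ptime_recode (h := fun y : bool * data => if y.1 then Dom y.2 else Sym y.2)
  (f := fun x => (true, X x))).
  by case=> [[]].
by apply: ptime_pair ptX; apply: ptime_const.
Qed.

Lemma ptime_Base G {eG : encoding G} (R : G -> sym) (t : G -> seq data) :
  ptime R -> ptime t -> ptime (fun x => Base (R x) (t x)).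
Proof.
move=> ptR ptt; apply: (ptime_recode (h := fun y : unit * (sym * seq data) => Base y.2.1 y.2.2)
  (f := fun x => (tt, (R x, t x)))).
  case=> [] [] [R0 t0].
  by change (Node Leaf (Node (of_sym R0) (of_seq t0)) = Node Leaf (Node (of_sym R0) (enc t0)));
    rewrite enc_seq_data.
by apply: ptime_pair; [apply: ptime_const | apply: ptime_pair].
Qed.

Lemma ptime_succ G {eG : encoding G} (n : G -> nat) :
  ptime n -> ptime (fun x => (n x).+1).
Proof.
move=> ptn; apply: (ptime_recode (h := fun y : unit * nat => y.2.+1) (f := fun x => (tt, n x))).
  by case=> [] [] k.
by apply: ptime_pair ptn; apply: ptime_const.
Qed.

(** Follows the syntax of the function and leaves the goals whose head is not listed. Under the
    binder of a [map] or a [has], a hypothesis about a function of the context must be composed with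
    the projection onto that context; this explains the recurrent [ptime_comp ptA _]. *)
Ltac ptime_tac :=
  cbv beta; try assumption; lazymatch goal with
  | |- ptime (fun x => x) => exact: ptime_id
  | |- ptime (fun _ => ?c) => exact: ptime_const
  | |- ptime fst => apply: ptime_fst; exact: ptime_id
  | |- ptime snd => apply: ptime_snd; exact: ptime_id
  | |- ptime (fun x => (_, _)) => apply: ptime_pair; ptime_tac
  | |- ptime (fun x => (_).1) => apply: ptime_fst; ptime_tac
  | |- ptime (fun x => (_).2) => apply: ptime_snd; ptime_tac
  | |- ptime (fun x => _ :: _) => apply: ptime_cons; ptime_tac
  | |- ptime (fun x => _ ++ _) => apply: ptime_cat; ptime_tac
  | |- ptime (fun x => behead _) => apply: ptime_behead; ptime_tac
  | |- ptime (fun x => nilp _) => apply: ptime_nilp; ptime_tac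
  | |- ptime (fun x => ~~ _) => apply: ptime_negb; ptime_tac
  | |- ptime (fun x => _ ==> _) => apply: ptime_implb; ptime_tac
  | |- ptime (fun x => size _) => apply: ptime_size; ptime_tac
  | |- ptime (fun x => S _) => apply: ptime_succ; ptime_tac
  | |- ptime (fun x => rev _) => apply: ptime_rev; ptime_tac
  | |- ptime (fun x => map _ _) => apply: ptime_map; ptime_tac
  | |- ptime (fun x => filter _ _) => apply: ptime_filter; ptime_tac
  | |- ptime (fun x => has _ _) => apply: ptime_has; ptime_tac
  | |- ptime (fun x => all _ _) => apply: ptime_all; ptime_tac
  | |- ptime (fun x => flatten _) => apply: ptime_flatten; ptime_tac
  | |- ptime (fun x => head Leaf _) => apply: ptime_head; ptime_tac
  | |- ptime (fun x => head [::] _) => apply: ptime_head_seq; ptime_tac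
  | |- ptime (fun x => nth Leaf _ _) => apply: ptime_nth; ptime_tac
  | |- ptime (fun x => nth [::] _ _) => apply: ptime_nth_seq; ptime_tac
  | |- ptime (fun x => nth 0 _ _) => apply: ptime_nth_nat; ptime_tac
  | |- ptime (fun x => sumn _) => apply: ptime_sumn; ptime_tac
  | |- ptime (fun x => iota _ _) => apply: ptime_iota; ptime_tac
  | |- ptime (fun x => _ == _) =>
      first [ apply: (ptime_eq enc_data_inj) | apply: (ptime_eq enc_sym_inj)
            | apply: (ptime_eq enc_vsym_inj) ]; ptime_tac
  | |- ptime (fun x => _ \in _) =>
      first [ apply: (ptime_mem enc_data_inj) | apply: (ptime_mem enc_sym_inj)
            | apply: (ptime_mem enc_vsym_inj) ]; ptime_tac
  | |- ptime (fun x => rsym _) => apply: ptime_rsym; ptime_tac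
  | |- ptime (fun x => rar _) => apply: ptime_rar; ptime_tac
  | |- ptime (fun x => rtup _) => apply: ptime_rtup; ptime_tac
  | |- ptime (fun x => univ _) => apply: ptime_univ; ptime_tac
  | |- ptime (fun x => rels _) => apply: ptime_rels; ptime_tac
  | |- ptime (fun x => Rel _ _ _) => apply: ptime_Rel; ptime_tac
  | |- ptime (fun x => Str _ _) => apply: ptime_Str; ptime_tac
  | |- ptime (fun x => Dom _) => apply: ptime_Dom; ptime_tac
  | |- ptime (fun x => Base _ _) => apply: ptime_Base; ptime_tac
  | |- ptime (fun x => if _ then _ else _) => apply: ptime_if; ptime_tac
  | _ => idtac
  end.

(** * Domain restriction, GAC and assignments in polynomial time *)

Lemma ptime_tuples_sym G {eG : encoding G} (A : G -> structure sym) R :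
  ptime A -> ptime R -> ptime (fun x => tuples (A x) (R x)).
Proof. by move=> ptA ptR; rewrite /tuples; ptime_tac; apply: ptime_comp ptR _; ptime_tac. Qed.

Lemma ptime_tuples_vsym G {eG : encoding G} (A : G -> structure vsym) R :
  ptime A -> ptime R -> ptime (fun x => tuples (A x) (R x)).
Proof. by move=> ptA ptR; rewrite /tuples; ptime_tac; apply: ptime_comp ptR _; ptime_tac. Qed.

Lemma ptime_restrict_left G {eG : encoding G} A O :
  ptime A -> ptime O -> ptime (fun x : G => restrict_left (A x) (O x)).
Proof.
move=> ptA ptO; rewrite /restrict_left /restricted /symbols; ptime_tac.
by apply: ptime_comp ptA _; ptime_tac.
Qed.

Lemma ptime_index G {eG : encoding G} (x : G -> data) s :
  ptime x -> ptime s -> ptime (fun g => index (x g) (s g)).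
Proof.
move=> ptx pts.
apply: (@ptime_ext _ _ _ _ (fun g => foldr (fun y n => if y == x g then 0 else n.+1) 0 (s g))).
  by move=> g; elim: (s g) => //= y t ->.
apply: (ptime_foldr_growth (F := fun g y n => if y == x g then 0 else n.+1) (z := fun=> 0)
  (c := fun=> 2)) => //; last 2 first.
- exact: pbounded_const.
- by move=> g n y; case: ifP => _; rewrite !esize_nat; lia.
- by ptime_tac; apply: ptime_comp ptx _; ptime_tac.
- exact: ptime_const.
Qed.

Lemma ptime_undup G {eG : encoding G} (s : G -> seq data) :
  ptime s -> ptime (fun g => undup (s g)).
Proof.
move=> pts.
apply: (@ptime_ext _ _ _ _
  (fun g => foldr (fun x u => if x \in u then u else x :: u) [::] (s g))).
  by move=> g; elim: (s g) => //= x t ->; rewrite mem_undup.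
apply: (ptime_foldr_growth (F := fun _ (x : data) u => if x \in u then u else x :: u)
  (z := fun=> [::]) (c := fun y => (esize y.2).+1)) => //.
- by ptime_tac.
- exact: ptime_const.
- by apply: pboundedS; apply: pbounded_esize; ptime_tac.
- by move=> g u x; case: ifP => _; rewrite ?esize_cons /=; lia.
Qed.

Lemma ptime_columns G {eG : encoding G} A B X :
  ptime A -> ptime B -> ptime X -> ptime (fun x : G => columns (A x) (B x) (X x)).
Proof.
move=> ptA ptB ptX; rewrite /columns; ptime_tac.
  by apply: ptime_tuples_sym; ptime_tac; apply: ptime_comp ptB _; ptime_tac.
by apply: ptime_comp ptX _; ptime_tac.
Qed.

Lemma ptime_restrict_right G {eG : encoding G} A B O c :
  ptime A -> ptime B -> ptime O -> ptime c ->
  ptime (fun x : G => restrict_right (A x) (B x) (O x) (c x)).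
Proof.
move=> ptA ptB ptO ptc; rewrite /restrict_right /restricted /symbols.
ptime_tac; last by apply: ptime_comp ptA _; ptime_tac.
apply: ptime_undup; ptime_tac.
  by apply: ptime_columns; ptime_tac; [apply: ptime_comp ptA _ | apply: ptime_comp ptB _];
     ptime_tac.
  by apply: ptime_comp ptc _; ptime_tac.
by apply: ptime_index; ptime_tac; apply: ptime_comp ptO _; ptime_tac.
Qed.

Lemma ptime_zip G {eG : encoding G} (s t : G -> seq data) :
  ptime s -> ptime t -> ptime (fun x => zip (s x) (t x)).
Proof.
move=> pts ptt.
(* The second component of the accumulator is the part of [t] not yet consumed; once it is empty,
   the rest of [s] is skipped, as [zip] does. *)
pose (F := fun (_ : G) (u : seq (data * data) * seq data) x =>
  if nilp u.2 then u else ((x, head Leaf u.2) :: u.1, behead u.2)).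
have foldF g l u : foldl (F g) u l = (rev (zip l u.2) ++ u.1, drop (size l) u.2).
  elim: l u => [|x l IHl] [u [|y v]] //=; rewrite IHl /=; first by case: l {IHl}.
  by rewrite -cat_rcons -rev_cons.
apply: (@ptime_ext _ _ _ _ (fun g => rev (foldl (F g) ([::], t g) (s g)).1)).
  by move=> g; rewrite foldF cats0 revK.
apply: ptime_rev; apply: ptime_fst.
apply: (ptime_foldl_growth (F := F) (z := fun g => ([::], t g))
  (c := fun y => (esize y.2).+2)) => //.
- by rewrite /F; ptime_tac.
- by ptime_tac.
- by apply: pboundedS; apply: pboundedS; apply: pbounded_esize; ptime_tac.
move=> g [u [|y v]] x; rewrite /F /=; first by rewrite leq_addr.
by rewrite !esize_pair !esize_cons !esize_pair; lia.
Qed.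

Lemma ptime_vtuple G {eG : encoding G} AV R :
  ptime AV -> ptime R -> ptime (fun x : G => vtuple (AV x) (R x)).
Proof.
move=> ptAV ptR; rewrite /vtuple; ptime_tac; exact: ptime_tuples_vsym.
Qed.

Lemma ptime_agree G {eG : encoding G} t b t' b' :
  ptime t -> ptime b -> ptime t' -> ptime b' ->
  ptime (fun x : G => agree (t x) (b x) (t' x) (b' x)).
Proof.
move=> ptt ptb ptt' ptb'.
apply: (@ptime_ext _ _ _ _ (fun x => all (fun u => all (fun v =>
   (u.1 == v.1) ==> (u.2 == v.2)) (zip (t' x) (b' x))) (zip (t x) (b x)))) => //.
ptime_tac; last exact: ptime_zip.
by apply: ptime_zip; [apply: ptime_comp ptt' _ | apply: ptime_comp ptb' _]; ptime_tac.
Qed.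

Lemma ptime_supported G {eG : encoding G} AV BV R b :
  ptime AV -> ptime BV -> ptime R -> ptime b ->
  ptime (fun x : G => supported (AV x) (BV x) (R x) (b x)).
Proof.
move=> ptAV ptBV ptR ptb; rewrite /supported /symbols.
have ptAV' : ptime (fun y : G * vsym => AV y.1) by apply: ptime_comp ptAV _; ptime_tac.
have ptR' : ptime (fun y : G * vsym => R y.1) by apply: ptime_comp ptR _; ptime_tac.
have ptV : ptime (fun y : G * vsym => vtuple (AV y.1) y.2).
  by apply: ptime_vtuple; ptime_tac.
have ptVR : ptime (fun y : G * vsym => vtuple (AV y.1) (R y.1)).
  by apply: ptime_vtuple.
apply: ptime_all; last by ptime_tac.
apply: ptime_implb; apply: ptime_has => //.
- by apply: (ptime_mem enc_data_inj); ptime_tac; apply: ptime_comp ptVR _; ptime_tac.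
- apply: ptime_agree; ptime_tac.
  + by apply: ptime_comp ptVR _; ptime_tac.
  + by apply: ptime_comp ptb _; ptime_tac.
  + by apply: ptime_comp ptV _; ptime_tac.
- by apply: ptime_tuples_vsym; ptime_tac; apply: ptime_comp ptBV _; ptime_tac.
Qed.

Lemma ptime_prune G {eG : encoding G} AV BV :
  ptime AV -> ptime BV -> ptime (fun x : G => prune (AV x) (BV x)).
Proof.
move=> ptAV ptBV; rewrite /prune; ptime_tac.
by apply: ptime_supported; ptime_tac; [apply: ptime_comp ptAV _ | apply: ptime_comp ptBV _];
  ptime_tac.
Qed.

Lemma esize_filter T {eT : encoding T} a (s : seq T) : esize (filter a s) <= esize s.
Proof. by elim: s => //= x s IHs; case: ifP => _; rewrite !esize_cons; lia. Qed.

Lemma leq_esize_map (T : eqType) {eT : encoding T} (f : T -> T) s :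
  {in s, forall x, esize (f x) <= esize x} -> esize (map f s) <= esize s.
Proof.
elim: s => //= x s IHs le_f; rewrite !esize_cons; have := le_f x (mem_head _ _).
by have := IHs (fun y s_y => le_f y (@mem_behead _ (x :: s) y s_y)); lia.
Qed.

Lemma esize_univ_lt (S : eqType) {eS : encoding S} (A : structure S) :
  esize (univ A) < esize A.
Proof. by rewrite -[esize A]/(esize (univ A, rels A)) esize_pair; lia. Qed.

Lemma esize_rels_lt (S : eqType) {eS : encoding S} (A : structure S) :
  esize (rels A) < esize A.
Proof. by rewrite -[esize A]/(esize (univ A, rels A)) esize_pair; lia. Qed.

Lemma esize_rtup_lt (S : eqType) {eS : encoding S} (r : relation S) :
  esize (rtup r) < esize r.
Proof. by rewrite -[esize r]/(esize (rsym r, (rar r, rtup r))) !esize_pair; lia. Qed.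

Lemma leq_esize_str (A A' : structure vsym) :
  univ A' = univ A -> esize (rels A') <= esize (rels A) -> esize A' <= esize A.
Proof.
move=> eqU le_rels; rewrite -[esize A]/(esize (univ A, rels A)) -[esize A']/(esize (univ A', rels A')).
by rewrite !esize_pair eqU; lia.
Qed.

Lemma leq_esize_rel (r r' : relation vsym) :
  rsym r' = rsym r -> rar r' = rar r -> esize (rtup r') <= esize (rtup r) ->
  esize r' <= esize r.
Proof.
move=> eqR eqn le_ts; rewrite -[esize r]/(esize (rsym r, (rar r, rtup r))).
rewrite -[esize r']/(esize (rsym r', (rar r', rtup r'))).
by rewrite !esize_pair eqR eqn; lia.
Qed.

Lemma esize_prune AV BV : esize (prune AV BV) <= esize BV.
Proof.
apply: leq_esize_str => //=; apply: leq_esize_map => r _.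
by apply: leq_esize_rel => //=; apply: esize_filter.
Qed.

(** Since the number of rounds varies with the structure, the iteration is polynomial because no
    round enlarges the code. The same fact later keeps all structures of the recursion below the
    initial one. *)
Lemma esize_gac AV BV : esize (gac AV BV) <= esize BV.
Proof. by rewrite /gac; elim: (sumn _) => //= n; apply: leq_trans (esize_prune _ _). Qed.

Lemma ptime_gac G {eG : encoding G} AV BV :
  ptime AV -> ptime BV -> ptime (fun x : G => gac (AV x) (BV x)).
Proof.
move=> ptAV ptBV; rewrite /gac.
apply: (ptime_iter (F := fun x => prune (AV x))) => //.
- by apply: ptime_prune; ptime_tac; apply: ptime_comp ptAV _; ptime_tac.
- by ptime_tac.
- by move=> g u; apply: esize_prune.
Qed.

Lemma ptime_dom_view G {eG : encoding G} X :
  ptime X -> ptime (fun x : G => dom_view (X x)).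
Proof. by move=> ptX; rewrite /dom_view; ptime_tac. Qed.

Lemma ptime_set_tuples G {eG : encoding G} BV R bs :
  ptime BV -> ptime R -> ptime bs ->
  ptime (fun x : G => set_tuples (BV x) (R x) (bs x)).
Proof.
move=> ptBV ptR ptbs; rewrite /set_tuples; ptime_tac.
- by apply: ptime_comp ptR _; ptime_tac.
- by apply: ptime_comp ptR _; ptime_tac.
- by apply: ptime_comp ptbs _; ptime_tac.
Qed.

(** * Delays in traces *)

Lemma outputs_cat tr tr' : outputs (tr ++ tr') = outputs tr ++ outputs tr'.
Proof. exact: pmap_cat. Qed.

Lemma outputs_ticks n : outputs (ticks n) = [::].
Proof. by elim: n. Qed.

(* The trace has an output; the numbers of ticks before the first output, between
   two outputs, and after the last one are bounded by a, K and b. *)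
Inductive paced (K b : nat) : nat -> trace -> Prop :=
  | PacedLast k x l a : k <= a -> l <= b ->
      paced K b a (ticks k ++ Some x :: ticks l)
  | PacedCons k x tr a : k <= a -> paced K b K tr ->
      paced K b a (ticks k ++ Some x :: tr).

Lemma paced_ticksl K b a j tr : paced K b a tr -> paced K b (j + a) (ticks j ++ tr).
Proof.
by case=> [k x l|k x {}tr] {}a le_k H; rewrite catA -ticksD; constructor;
  rewrite ?leq_add2l.
Qed.

Lemma paced_le K b a a' tr : a <= a' -> paced K b a tr -> paced K b a' tr.
Proof.
move=> le_a pt; case: pt le_a => [k x l|k x {}tr] {}a le_k H le_a; constructor=> //;
  exact: leq_trans le_a.
Qed.

Lemma paced_ticksr K b a j tr : paced K b a tr -> paced K (b + j) a (tr ++ ticks j).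
Proof.
elim=> [k x l|k x {}tr] {}a le_k H => [|IH]; rewrite -catA /=.
  by rewrite -ticksD; constructor; rewrite ?leq_add2r.
exact: PacedCons.
Qed.

(** The gap across the seam consists of the last ticks of [tr1] and the first ones of [tr2]; all
    other gaps are inherited. *)
Lemma paced_cat K b1 b2 a a2 tr1 tr2 : b1 + a2 <= K ->
  paced K b1 a tr1 -> paced K b2 a2 tr2 -> paced K b2 a (tr1 ++ tr2).
Proof.
move=> le_K + pt2; elim=> [k x l|k x {}tr1] {}a le_k H => [|IH]; rewrite -catA /=.
  apply: PacedCons => //; apply: paced_le (paced_ticksl l pt2).
  by apply: leq_trans le_K; rewrite leq_add2r.
exact: PacedCons.
Qed.

Lemma ticks_inj k x tr j v tr2 :
  ticks k ++ Some x :: tr = ticks j ++ Some v :: tr2 :> trace -> j = k.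
Proof. by elim: k j => [|k IHk] [|j] //= [] => /IHk->. Qed.

(** A block of ticks contains no output, so it cannot straddle [Some x]: it lies before it or after
    it. *)
Lemma ticks_split k x tr tr1 j v tr2 :
  ticks k ++ Some x :: tr = tr1 ++ ticks j ++ Some v :: tr2 ->
  j <= k \/ exists tr1', tr = tr1' ++ ticks j ++ Some v :: tr2.
Proof.
elim: k tr1 => [|k IHk] [|o tr1]; try by move/ticks_inj=> ->; left.
  by case=> _ ->; right; exists tr1.
by case=> _ /IHk[le_j|]; [left; apply: leqW | right].
Qed.

Lemma paced_delay K b a tr : a <= K -> paced K b a tr ->
  forall tr1 k v tr2, tr = tr1 ++ ticks k ++ Some v :: tr2 -> k <= K.
Proof.
move=> + pt; elim: pt => [k x l|k x {}tr] {}a le_k H => [|IH] le_a tr1 j v tr2 /ticks_split[le_j|].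
- exact: leq_trans le_j (leq_trans le_k le_a).
- case=> tr1' eq_l; have: outputs (ticks l) = outputs (tr1' ++ ticks j ++ Some v :: tr2).
    by rewrite eq_l.
  by rewrite outputs_ticks !outputs_cat; case: (outputs tr1') => //=; case: (outputs (ticks j)).
- exact: leq_trans le_j (leq_trans le_k le_a).
by case=> tr1'; apply: IH.
Qed.

(** * The recursion of [Propagate] as an iteration on a stack *)

(** A pending call. The variables still to be assigned come first: two heads reach them from the
    stack, and their code is [Leaf] exactly when the call is complete. *)
Notation task := (seq data * (structure vsym * seq data))%type.

Definition active (AV BV : structure vsym) (X : data) : seq data :=
  [seq head Leaf b | b <- tuples (gac AV BV) (dom_view X)].

Definition assign (AV BV : structure vsym) (X a : data) : structure vsym :=
  set_tuples (gac AV BV) (dom_view X) [:: [:: a]].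

Definition subtasks AV (X : data) Xs BV pre : seq task :=
  [seq (Xs, (assign AV BV X a, rcons pre a)) | a <- active AV BV X].

(** On an empty list of variables [Propagate] returns nothing, since the last variable is treated in
    the call before. Returning the finished tuple instead makes the recursion uniform; the two agree
    on nonempty lists. *)
Definition enumerate AV Xs BV pre : seq (seq data) :=
  if Xs is [::] then [:: pre] else Propagate AV Xs BV pre.

Lemma enumerate_cons AV X Xs BV pre : enumerate AV (X :: Xs) BV pre =
  flatten [seq enumerate AV Xs (assign AV BV X a) (rcons pre a) | a <- active AV BV X].
Proof. by rewrite /=; congr flatten; apply: eq_map => a; case: Xs. Qed.

(* No call below this one is a dead end; D bounds the branching, W the sizes. *)
Fixpoint tame (AV : structure vsym) (W D : nat)
    (Xs : seq data) (BV : structure vsym) (pre : seq data) : Prop :=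
  esize (Xs, (BV, pre)) <= W /\
  if Xs is X :: Xs' then
    0 < size (active AV BV X) <= D /\
    forall a, a \in active AV BV X -> tame AV W D Xs' (assign AV BV X a) (rcons pre a)
  else True.

Lemma tame_size AV W D (Xs : seq data) (BV : structure vsym) (pre : seq data) :
  tame AV W D Xs BV pre -> esize (Xs, (BV, pre)) <= W.
Proof. by case: Xs => [|X Xs] []. Qed.

(** The code of [(t, ts)] is that of the stack [t :: ts], so this function applies to the state of
    the loop as it stands. The loop calls it when a variable remains, hence the default [Leaf] does
    not matter. *)
Definition expand (y : structure vsym * (task * seq task)) : structure vsym * seq task :=
  (y.1, subtasks y.1 (head Leaf y.2.1.1) (behead y.2.1.1) y.2.1.2.1 y.2.1.2.2 ++ y.2.2).

Lemma ptime_rcons G {eG : encoding G} (s : G -> seq data) x :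
  ptime s -> ptime x -> ptime (fun g => rcons (s g) (x g)).
Proof.
move=> pts ptx; apply: (@ptime_ext _ _ _ _ (fun g => s g ++ [:: x g])).
  by move=> g; rewrite cats1.
by ptime_tac.
Qed.

Lemma ptime_expand : ptime expand.
Proof.
rewrite /expand /subtasks /active /assign; ptime_tac.
- by apply: ptime_set_tuples; [apply: ptime_gac | apply: ptime_dom_view |]; ptime_tac.
- by apply: ptime_rcons; ptime_tac.
by apply: ptime_tuples_vsym; [apply: ptime_gac | apply: ptime_dom_view]; ptime_tac.
Qed.

(** * The loop on the stack and the pace of its outputs *)

Section Machine.
Variables (P : prog) (q : {poly nat}).
Hypothesis runP : forall y, computes P q.[esize y]%R (enc y) (enc (expand y)).

(** [pEmit] returns its argument, so the emitted tuple is paired with the popped state and then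
    dropped by the last [pTail]. *)
Definition emit_top : prog :=
  pSeq (pPair (pSeq (pSeq pTail (pSeq pHead (pSeq pTail pTail))) pEmit)
              (pPair pHead (pSeq pTail pTail))) pTail.
Definition loop : prog :=
  pWhile pTail (pIf (pSeq pTail (pSeq pHead pHead)) P emit_top).

(** The big-step semantics has no runs that end inside a loop. A partial run is therefore a trace
    that can be put in front of any run of the loop from the later state. *)
Definition steps (AV : structure vsym) (ts : seq task) tr (ts' : seq task) : Prop := forall tr' z,
  exec loop (enc (AV, ts')) tr' z -> exec loop (enc (AV, ts)) (tr ++ tr') z.

Lemma steps_trans (AV : structure vsym) ts2 ts1 ts3 tr1 tr2 :
  steps AV ts1 tr1 ts2 -> steps AV ts2 tr2 ts3 -> steps AV ts1 (tr1 ++ tr2) ts3.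
Proof. by move=> st1 st2 tr z run; rewrite -catA; apply/st1/st2. Qed.

(** [q] pays for a call of [expand]; the linear term covers the tests and projections of one round
    of the loop, or all of [emit_top]. Any sufficiently large coefficient would do. *)
Definition step_time : {poly nat} := ((30%:P : {poly nat}) * 'X + q)%R.

Lemma step_timeE n : step_time.[n]%R = 30 * n + q.[n]%R.
Proof. by rewrite /step_time hornerD hornerM hornerC hornerX. Qed.

Lemma loop_stop (AV : structure vsym) :
  computes loop (step_time.[esize (AV, Nil task)]%R)
  (enc (AV, Nil task)) (enc (AV, Nil task)).
Proof.
exists (esize (AV, Nil task) + esize (AV, Nil task)); first by rewrite step_timeE; lia.
by rewrite ticksD; apply: ExecWhileDone; apply: (ExecTail (enc (AV, Nil task))).
Qed.

Lemma steps_expand (AV : structure vsym) X Xs BV pre ts : exists2 k,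
  k <= step_time.[esize (AV, (X :: Xs, (BV, pre)) :: ts)]%R &
  steps AV ((X :: Xs, (BV, pre)) :: ts) (ticks k) (subtasks AV X Xs BV pre ++ ts).
Proof.
pose (y := (AV, ((X :: Xs, (BV, pre)), ts))); set n := esize _.
have eqy: enc y = enc (AV, (X :: Xs, (BV, pre)) :: ts) by [].
have [k le_k run] : computes (pIf (pSeq pTail (pSeq pHead pHead)) P emit_top)
    (20 * n + q.[n]%R) (enc y) (enc (expand y)).
  apply: (@computes_le _ (n + (n + (n + (n + (n + n))) + q.[n]%R))); first by lia.
  have [k1 le_k1 run1] := runP y.
  apply: (@computes_if _ _ _ _ _ _ (enc (X :: Xs))); last by exists k1.
  have sz : dsize (enc (X :: Xs)) <= n.
    by rewrite /n /esize /=; lia.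
  have sz1 : dsize (enc ((X :: Xs, (BV, pre)) :: ts)) <= n.
    by rewrite /n /esize /=; lia.
  have sz2 : dsize (enc (X :: Xs, (BV, pre))) <= n.
    by rewrite /n /esize /=; lia.
  apply: computes_seq; first exact: computes_tail.
  apply: (computes_le _ (computes_seq (computes_head _) (computes_head _))).
  by move: sz1 sz2; rewrite /= /enc_pair /= /enc_pair /=; lia.
exists (n + (n + k)); first by rewrite step_timeE; lia.
move=> tr z run'; rewrite !ticksD -!catA.
by apply: ExecWhileLoop (ExecTail _) _ run run'.
Qed.

Lemma steps_emit (AV : structure vsym) BV pre ts : exists k l,
  [/\ k <= step_time.[esize (AV, (Nil data, (BV, pre)) :: ts)]%R,
      l <= step_time.[esize (AV, (Nil data, (BV, pre)) :: ts)]%R &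
      steps AV ((Nil data, (BV, pre)) :: ts) (ticks k ++ Some (of_seq pre) :: ticks l) ts].
Proof.
set n := esize _.
pose (y := enc (AV, (Nil data, (BV, pre)) :: ts)).
have sz : dsize y = n by [].
have sz1 : dsize (enc ((Nil data, (BV, pre)) :: ts)) <= n by rewrite /n /esize /=; lia.
have sz2 : dsize (enc (Nil data, (BV, pre))) <= n by rewrite /n /esize /=; lia.
have sz3 : dsize (enc (BV, pre)) <= n by move: sz2; rewrite /= /enc_pair /=; lia.
have [kc le_c runc] : computes (pSeq pTail (pSeq pHead pHead)) (5 * n) y Leaf.
  apply: computes_le (computes_seq (computes_tail _)
    (computes_seq (computes_head _) (computes_head _))).
  by move: sz sz1 sz2; rewrite /y /= /enc_pair /=; lia.
have [kp le_p runp] : computes (pSeq pTail (pSeq pHead (pSeq pTail pTail))) (7 * n) y (enc pre).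
  apply: computes_le (computes_seq (computes_tail _)
    (computes_seq (computes_head _) (computes_seq (computes_tail _) (computes_tail _)))).
  by move: sz sz1 sz2 sz3; rewrite /= /enc_pair /=; lia.
have [kq le_q runq] : computes (pPair pHead (pSeq pTail pTail)) (5 * n) y (enc (AV, ts)).
  apply: computes_le (computes_pair (computes_head _)
    (computes_seq (computes_tail _) (computes_tail _))).
  by move: sz sz1; rewrite /= /enc_pair /=; lia.
have szpre : dsize (enc pre) <= n by move: sz3; rewrite /= /enc_pair /=; lia.
have szts : esize (AV, ts) <= n by rewrite /n !esize_pair esize_cons; lia.
have n_gt0 : 0 < n by exact: esize_gt0.
rewrite /esize in szts; move Ec: (dsize (enc (AV, ts))) szts => c szts.
exists (n + (n + (n + (kc + (n + (n + (n + (kp + dsize (enc pre))))))))).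
exists (kq + (dsize (enc pre) + c).+1).
split; [by rewrite step_timeE; lia | by rewrite step_timeE; lia |].
have szN : dsize (Node (enc pre) (enc (AV, ts))) = (dsize (enc pre) + c).+1.
  by rewrite -Ec.
move=> tr z run; rewrite -[of_seq pre]enc_seq_data.
have := ExecWhileLoop (v := enc ((Nil data, (BV, pre)) :: ts)) (ExecTail y) _
  (ExecIfFalse P runc (ExecSeq (ExecPair (ExecSeq runp (ExecEmit _)) runq) (ExecTail _))) run.
rewrite -/loop -/y szN sz.
by rewrite !ticksD -!catA /= -?catA; apply.
Qed.

(** The first output takes one expansion per remaining variable and an emission, whence
    [(size Xs).+1] steps. After the last output only the end of one step remains, because an
    expanded call has been replaced by its subcalls; so a gap is at most [(size Xs).+2] steps. Each
    level of the recursion keeps at most [D] tasks of size at most [W] on the stack, whence the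
    bound [M] on the states. The outputs are described without [tame], since the program has to
    implement the algorithm on all instances. *)
Lemma steps_task (AV : structure vsym) (Xs : seq data) (BV : structure vsym)
    (pre : seq data) (ts : seq task) : exists tr,
  [/\ steps AV ((Xs, (BV, pre)) :: ts) tr ts,
      outputs tr = map of_seq (enumerate AV Xs BV pre) &
      forall W D M K, tame AV W D Xs BV pre ->
        esize AV + esize ts + W.+1 * (size Xs * D).+1 + 2 <= M ->
        step_time.[M]%R * (size Xs).+2 <= K ->
        paced K step_time.[M]%R (step_time.[M]%R * (size Xs).+1) tr].
Proof.
elim: Xs BV pre ts => [|X Xs IHXs] BV pre ts.
  have [k [l [le_k le_l st]]] := steps_emit AV BV pre ts.
  exists (ticks k ++ Some (of_seq pre) :: ticks l); split=> //.
    by rewrite outputs_cat /= !outputs_ticks.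
  move=> W D M K [le_W _] le_M le_K; rewrite muln1.
  have le_n : esize (AV, ((Nil data, (BV, pre)) : task) :: ts) <= M.
    by rewrite esize_pair esize_cons; move: le_W le_M; rewrite mul0n muln1; lia.
  by constructor; [apply: leq_trans le_k _ | apply: leq_trans le_l _]; apply: leq_horner.
have [k le_k st] := steps_expand AV X Xs BV pre ts.
have {IHXs} loopXs (l : seq data) : exists tr,
  [/\ steps AV ([seq (Xs, (assign AV BV X a, rcons pre a)) | a <- l] ++ ts) tr ts,
      outputs tr = map of_seq
        (flatten [seq enumerate AV Xs (assign AV BV X a) (rcons pre a) | a <- l]) &
      forall W D M K, 0 < size l ->
        (forall a, a \in l -> tame AV W D Xs (assign AV BV X a) (rcons pre a)) ->
        esize AV + esize ts + W.+1 * (size l + size Xs * D) + 2 <= M ->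
        step_time.[M]%R * (size Xs).+2 <= K ->
        paced K step_time.[M]%R (step_time.[M]%R * (size Xs).+1) tr].
  elim: l => [|a l [tr2 [st2 out2 pace2]]]; first by exists [::]; split=> // W D M K.
  have [tr1 [st1 out1 pace1]] := IHXs (assign AV BV X a) (rcons pre a)
    ([seq (Xs, (assign AV BV X a, rcons pre a)) | a <- l] ++ ts).
  (* With no sibling left, the hypothesis gives no pace for [tr2]; as the stack is then already
     [ts], the empty trace serves instead. *)
  exists (tr1 ++ (if nilp l then [::] else tr2)); split.
  - apply: steps_trans st1 _; case: ifP => [/nilP l0|_]; [by rewrite l0 | exact: st2].
  - rewrite outputs_cat out1 /= map_cat -out2; congr cat; case: ifP => [/nilP l0|_] //.
    by rewrite out2 l0.
  move=> W D M K _ tm le_M le_K.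
  have le_l : esize ([seq (Xs, (assign AV BV X a, rcons pre a)) | a <- l] ++ ts) <=
      W.+1 * size l + esize ts.
    elim: l tm {st1 st2 out1 out2 pace1 pace2 le_M} => [|a' l IHl] tm; first by rewrite muln0.
    rewrite /= esize_cons.
    have := tame_size (tm a' _); rewrite !in_cons eqxx orbT => /(_ isT).
    have tm' a0 : a0 \in a :: l -> tame AV W D Xs (assign AV BV X a0) (rcons pre a0).
      by rewrite in_cons => H; apply: tm; rewrite !in_cons orbCA H orbT.
    by have := IHl tm'; rewrite mulnS; lia.
  have {le_l} pc1 : paced K step_time.[M]%R (step_time.[M]%R * (size Xs).+1) tr1.
    apply: (pace1 W D) => //; first by apply: tm; rewrite in_cons eqxx.
    by move: le_M le_l => /=; rewrite !mulnS mulnDr; lia.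
  case: ifP => [_|l_n0]; first by rewrite cats0.
  apply: paced_cat pc1 _; last first.
    apply: (pace2 W D) => //; first by case: (l) l_n0.
      by move=> a' l_a'; apply: tm; rewrite in_cons l_a' orbT.
    by apply: leq_trans le_M => /=; rewrite leq_add2r leq_add2l leq_mul2l addSn leqnSn orbT.
  by rewrite addnC -mulnSr.
have [tr [st' out pace]] := loopXs (active AV BV X).
exists (ticks k ++ tr); split.
- exact: steps_trans st st'.
- by rewrite outputs_cat outputs_ticks enumerate_cons.
move=> W D M K tm; have := tame_size tm; case: tm => _ [/andP[n_gt0 le_n] tm] le_W le_M le_K.
have le_k' : k <= step_time.[M]%R.
  apply: leq_trans le_k _; apply: leq_horner; rewrite esize_pair esize_cons.
  by move: le_M; rewrite mulnS; lia.
rewrite [size (X :: Xs)]/= mulnS; apply: (@paced_le _ _ (k + step_time.[M]%R * (size Xs).+1)).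
  by rewrite leq_add2r.
apply: paced_ticksl; apply: (pace W D) => //.
  apply: leq_trans le_M; rewrite leq_add2r leq_add2l leq_mul2l /=.
  by rewrite mulSn; lia.
by apply: leq_trans le_K; rewrite leq_mul2l ltnW ?orbT.
Qed.
End Machine.

(** * Local consistency on acyclic hypergraphs *)

Section JoinTree.
Local Open Scope fset_scope.

Lemma path_leaves (T : eqType) (r : rel T) (S : pred T) x p :
  path r x p -> S x -> ~~ S (last x p) ->
  exists w w', [/\ S w, ~~ S w', w' \in p & r w w'].
Proof.
elim: p x => [|y p IHp] x /=; first by move=> _ ->.
case/andP=> rxy py Sx Slast; case Sy: (S y).
  have [w [w' [Sw Sw' p_w' rww']]] := IHp y py Sy Slast.
  by exists w, w'; rewrite in_cons p_w' orbT.
by exists x, y; rewrite Sy mem_head.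
Qed.

Variables (H : hypergraph) (r : rel {fset data}) (V : Type).
Variable Rl : {fset data} -> (data -> V) -> Prop.
Hypothesis joinH : join_tree H r.
Hypothesis Rl_ext : forall e f g, e \in edges H -> {in e, f =1 g} -> Rl e f -> Rl e g.
Hypothesis Rl_cons : forall e e' f, e \in edges H -> e' \in edges H -> Rl e f ->
  exists2 g, Rl e' g & {in e `&` e', f =1 g}.

(** A vertex outside [S] cannot repeat on a path inside [S]. With the next lemma, this keeps a
    subtree connected when a leaf is attached to it. *)
Lemma simple_path_cons (S : {fset {fset data}}) u v w p : symmetric r ->
  S `<=` edges H -> w \in edges H -> w \notin S -> r u w -> u \in S ->
  simple_path (edges H) r u v p -> {subset p <= S} ->
  simple_path (edges H) r w v (u :: p).
Proof.
move=> symr sub w_H w_S ruw u_S [subp pathp uniqp lastp] subS; split=> //=.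
- by move=> x; rewrite in_cons => /orP[/eqP->//|]; apply: subp.
- by rewrite symr ruw.
- rewrite -/(uniq (u :: p)) uniqp andbT in_cons negb_or; apply/andP; split.
    by apply: contraNneq w_S => ->.
  by apply: contra w_S; apply: subS.
Qed.

Lemma simple_path_rcons (S : {fset {fset data}}) u v w p :
  S `<=` edges H -> w \in edges H -> w \notin S -> r u w -> u \in S -> v \in S ->
  simple_path (edges H) r v u p -> {subset p <= S} ->
  simple_path (edges H) r v w (rcons p w).
Proof.
move=> sub w_H w_S ruw u_S v_S [subp pathp uniqp lastp] subS; split.
- move=> x; rewrite -rcons_cons mem_rcons in_cons => /orP[/eqP->//|]; exact: subp.
- by rewrite rcons_path pathp lastp.
- rewrite -rcons_cons rcons_uniq uniqp andbT in_cons negb_or; apply/andP; split.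
    by apply: contraNneq w_S => ->.
  by apply: contra w_S; apply: subS.
- by rewrite last_rcons.
Qed.

(** A subtree [S] on whose edges [f] is consistent grows by one neighbour at a time. A node shared
    by the new edge and some edge of [S] also occurs in the edge of [S] to which the new one is
    attached, and there the old and the new values coincide. *)
Lemma join_tree_extend e0 f0 : e0 \in edges H -> Rl e0 f0 ->
  exists2 f, {in e0, f =1 f0} & forall e, e \in edges H -> Rl e f.
Proof.
move=> e0_H Rl0; have [[symr _ treeH] joinP] := joinH.
(* Connectedness of [S] is expressed by simple paths inside [S], the form to which the path
   condition of a join tree applies. The induction is on the number of edges outside [S]. *)
suff ext n (S : {fset {fset data}}) f : #|` edges H `\` S| <= n -> S `<=` edges H ->
    e0 \in S -> (forall u v, u \in S -> v \in S ->
      exists2 p, simple_path (edges H) r u v p & {subset p <= S}) ->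
    {in e0, f =1 f0} -> (forall e, e \in S -> Rl e f) ->
    exists2 f, {in e0, f =1 f0} & forall e, e \in edges H -> Rl e f.
  apply: (ext _ [fset e0] f0 (leqnn _)) => //.
  - by rewrite fsub1set.
  - by rewrite in_fset1.
  - move=> u v /fset1P-> /fset1P->; exists [::] => //.
    by split=> // x; rewrite inE => /eqP->.
  - by move=> e /fset1P->.
elim: n S f => [|n IHn] S f le_n sub_S S_e0 conn_S eq_f0 Rl_f.
  move: le_n; rewrite leqn0 cardfs_eq0 fsetD_eq0 => sub_H.
  by exists f => // e e_H; apply: Rl_f; apply: (fsubsetP sub_H).
have [sub_H|] := boolP (edges H `<=` S).
  by exists f => // e e_H; apply: Rl_f; apply: (fsubsetP sub_H).
case/fsubsetPn => u u_H u_S.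
have [p [[subp pathp uniqp lastp] _]] := treeH e0 u e0_H u_H.
have [w [w' [S_w S_w' p_w' rww']]] : exists w w', [/\ w \in S, w' \notin S, w' \in p & r w w'].
  by apply: (@path_leaves _ _ (mem S) e0) => //=; rewrite lastp.
have w'_H: w' \in edges H by apply: subp; rewrite in_cons p_w' orbT.
have w_H: w \in edges H by apply: (fsubsetP sub_S).
have [g Rl_g eq_g] := Rl_cons w_H w'_H (Rl_f _ S_w).
pose f' x := if x \in w' then g x else f x.
have eq_f' e : e \in S -> {in e, f =1 f'}.
  move=> S_e x e_x; rewrite /f'; case: ifP => // w'_x.
  have [q pq subq] := conn_S e w S_e S_w.
  have e_H: e \in edges H by apply: (fsubsetP sub_S).
  have pq' := simple_path_rcons sub_S w'_H S_w' rww' S_w S_e pq subq.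
  apply: eq_g; rewrite in_fsetI w'_x andbT.
  apply: (joinP _ _ _ e_H w'_H pq' x e_x w'_x).
  case: pq => _ _ _ <-; rewrite -rcons_cons mem_rcons in_cons.
  by rewrite mem_last orbT.
apply: (IHn (w' |` S) f').
- rewrite -ltnS; apply: leq_trans le_n; apply: fproper_ltn_card.
  rewrite fproperE; apply/andP; split.
    by apply/fsubsetP => x; rewrite !in_fsetD in_fset1U negb_or => /andP[/andP[_ ->] ->].
  by apply/fsubsetPn; exists w'; rewrite !in_fsetD ?S_w' ?w'_H // in_fset1U eqxx.
- by apply/fsubsetP => x; rewrite in_fset1U => /orP[/eqP->|/(fsubsetP sub_S)].
- by rewrite in_fset1U S_e0 orbT.
- have subS x : x \in S -> x \in w' |` S by rewrite in_fset1U orbC => ->.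
  move=> u1 v1; rewrite !in_fset1U => /orP[/eqP->|S_u1] /orP[/eqP->|S_v1].
  + by exists [::] => //; split=> // x; rewrite inE => /eqP->.
  + have [q pq subq] := conn_S w v1 S_w S_v1.
    exists (w :: q); first exact: simple_path_cons pq subq.
    by move=> x; rewrite in_cons => /orP[/eqP->|/subq]; apply: subS.
  + have [q pq subq] := conn_S u1 w S_u1 S_w.
    exists (rcons q w'); first exact: simple_path_rcons pq subq.
    move=> x; rewrite mem_rcons in_cons => /orP[/eqP->|/subq]; last exact: subS.
    by rewrite in_fset1U eqxx.
  + have [q pq subq] := conn_S u1 v1 S_u1 S_v1.
    by exists q => // x /subq; apply: subS.
- by move=> x e0_x; rewrite -eq_f0 // -(eq_f' e0).
- move=> e; rewrite in_fset1U => /orP[/eqP->|S_e].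
    by apply: (Rl_ext w'_H _ Rl_g) => x w'_x; rewrite /f' w'_x.
  exact: (Rl_ext (fsubsetP sub_S _ S_e) (eq_f' e S_e)) (Rl_f e S_e).
Qed.

End JoinTree.

(** * Tuples, hyperedges and disjoint unions *)

Section Tuples.
Variable S : eqType.
Implicit Types (A : structure S) (R : S).

Lemma tuplesP A R t :
  reflect (exists2 r, r \in rels A & rsym r = R /\ t \in rtup r) (t \in tuples A R).
Proof.
apply: (iffP flatten_mapP) => [[r]|[r r_A [<- r_t]]].
  by rewrite mem_filter => /andP[/eqP r_R r_A] r_t; exists r.
by exists r => //; rewrite mem_filter eqxx.
Qed.

Lemma wf_tuple A R t : wf A -> t \in tuples A R ->
  0 < size t /\ {subset t <= univ A}.
Proof.
case/and3P=> _ _ /allP wfA /tuplesP[r r_A [_ r_t]].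
have /and3P[ar_gt0 _ /allP/(_ t r_t)/andP[/eqP-> /allP sub]] := wfA r r_A.
by split.
Qed.

Lemma tuples_symbols A R t : t \in tuples A R -> R \in symbols A.
Proof. by case/tuplesP=> r r_A [<- _]; apply: map_f. Qed.

Lemma tuples_rel A r : uniq (symbols A) -> r \in rels A -> tuples A (rsym r) = rtup r.
Proof.
case: A => U s; rewrite /symbols /tuples /=; elim: s => //= r0 s IHs.
case/andP=> s_r0 uniq_s; rewrite in_cons => /orP[/eqP->|s_r].
  rewrite eqxx /= [X in _ ++ flatten (map _ X)](_ : _ = [::]) ?cats0 //.
  apply/eqP; rewrite -[_ == _]negbK -has_filter; apply: contra s_r0 => /hasP[r1 s_r1 /eqP<-].
  exact: map_f.
case: eqP => [eq_r|_]; last exact: IHs.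
by case/negP: s_r0; rewrite eq_r map_f.
Qed.

Lemma hyper_edge A R t : t \in tuples A R -> fset_of t \in edges (hyper A).
Proof.
case/tuplesP=> r r_A [_ r_t]; apply/imfsetP; exists t => //=.
by apply/flatten_mapP; exists r.
Qed.

Lemma hyper_edgeP A e : e \in edges (hyper A) ->
  exists R t, t \in tuples A R /\ e = fset_of t.
Proof.
case/imfsetP=> t /= /flatten_mapP[r r_A r_t] ->.
by exists (rsym r), t; split=> //; apply/tuplesP; exists r.
Qed.

Lemma in_fset_of (s : seq data) x : (x \in fset_of s) = (x \in s).
Proof. by rewrite /fset_of in_fset. Qed.

End Tuples.

Lemma tuples_union_inl (S T : eqType) (A : structure S) (A' : structure T) R :
  tuples (disjoint_union A A') (inl R) = tuples A R.
Proof.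
rewrite /tuples /= filter_cat map_cat flatten_cat [X in _ ++ X](_ : _ = [::]) ?cats0.
  by rewrite filter_map -map_comp.
by rewrite filter_map -map_comp /=; elim: (rels A').
Qed.

Lemma tuples_union_inr (S T : eqType) (A : structure S) (A' : structure T) R :
  tuples (disjoint_union A A') (inr R) = tuples A' R.
Proof.
rewrite /tuples /= filter_cat map_cat flatten_cat [X in X ++ _](_ : _ = [::]).
  by rewrite filter_map -map_comp.
by rewrite filter_map -map_comp /=; elim: (rels A).
Qed.

Lemma mem_singletons O X t :
  (t \in tuples (singletons O) X) = (X \in O) && (t == [:: X]).
Proof.
apply/tuplesP/andP => [[r /mapP[Y O_Y ->]] [<-]|[O_X /eqP->]].
  by rewrite mem_seq1.
by exists (Rel X 1 [:: [:: X]]); rewrite ?mem_seq1 //; apply/mapP; exists X.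
Qed.

(** * From locally consistent views to homomorphisms *)

Section GacExtend.
Variables (A B : structure sym) (O : seq data) (AV BV : structure vsym).
Hypothesis viewAV : view_structure A AV.
Hypotheses (wfB : wf B) (wfBV : wf BV) (vocBV : voc BV =i voc AV).
Hypothesis baseBV : forall R t, t \in tuples A R ->
  {subset tuples BV (Base R t) <= tuples B R}.
Hypothesis connA : connected A.
Hypothesis coverA : forall x, x \in univ A -> exists R t, t \in tuples A R /\ x \in t.
Hypothesis domA : forall X, X \in O -> [:: X] \in tuples A (Dom X).
Variables (A' : structure (sym + data)%type) (Ha : hypergraph).
Hypothesis coreA : core A' (disjoint_union A (singletons O)).
Hypothesis projA : tree_projection (hyper A') (hyper AV) Ha.

Let C := gac AV BV.

Lemma base_view R t : t \in tuples A R ->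
  Base R t \in symbols AV /\ vtuple AV (Base R t) = t.
Proof. by have [_ _ _] := viewAV; apply. Qed.

Lemma vtuple_neq0 R : R \in symbols AV -> vtuple AV R != [::].
Proof.
move=> AV_R; have [wfAV _ _ _] := viewAV.
have [] := wf_tuple wfAV (vtupleP viewAV AV_R).
by rewrite lt0n size_eq0.
Qed.

Lemma gac_meet R R' x f : R \in symbols AV -> R' \in symbols AV ->
  x \in vtuple AV R -> x \in vtuple AV R' -> map f (vtuple AV R) \in tuples C R ->
  exists2 g, map g (vtuple AV R') \in tuples C R' &
    forall y, y \in vtuple AV R -> y \in vtuple AV R' -> f y = g y.
Proof.
move=> AV_R AV_R' Rx R'x C_f.
have [_ proj] := consistent_gac viewAV wfBV vocBV.
have cn0 : common AV R R' <> [::].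
  by move=> c0; have: x \in common AV R R'; [rewrite mem_filter R'x | rewrite c0].
have [/(_ (ex_intro2 _ _ f C_f erefl))[g C_g /eq_in_map eq_g] _] :=
  proj R R' AV_R AV_R' cn0 (map f (common AV R R')).
by exists g => // y Ry R'y; apply: eq_g; rewrite mem_filter R'y.
Qed.

(** GAC relates only views with a common variable. Two arbitrary views are linked by a path in the
    hypergraph of [A]; each hyperedge on it is a base view and shares a variable with the preceding
    view. *)
Lemma gac_nonempty R R' f : R \in symbols AV -> R' \in symbols AV ->
  map f (vtuple AV R) \in tuples C R -> exists g, map g (vtuple AV R') \in tuples C R'.
Proof.
move=> AV_R AV_R' C_f; have [wfAV univAV _ _] := viewAV.
have vars R1 x : R1 \in symbols AV -> x \in vtuple AV R1 -> x \in univ A.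
  move=> AV_R1; have [_ sub] := wf_tuple wfAV (vtupleP viewAV AV_R1).
  by move=> /sub; rewrite univAV.
have [x Rx] : exists x, x \in vtuple AV R.
  by case: (vtuple AV R) (vtuple_neq0 AV_R) => // x s _; exists x; apply: mem_head.
have [y R'y] : exists y, y \in vtuple AV R'.
  by case: (vtuple AV R') (vtuple_neq0 AV_R') => // y s _; exists y; apply: mem_head.
have [|| p + lastp] := @connA x y; rewrite ?in_fset_of.
- exact: vars Rx.
- exact: vars R'y.
elim: p x R f AV_R Rx C_f lastp => [|z p IHp] x R1 f1 AV_R1 R1x C_f1 /=.
  move=> eq_xy _; have [|g C_g _] := gac_meet AV_R1 AV_R' R1x _ C_f1; last by exists g.
  by rewrite eq_xy.
move=> lastp /andP[/hasP[e /hyper_edgeP[R2 [t [A_t ->]]]]].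
rewrite !in_fset_of => /andP[t_x t_z] pathp.
have [AV_t eq_t] := base_view A_t.
have [|g C_g _] := gac_meet AV_R1 AV_t R1x _ C_f1; first by rewrite eq_t.
by apply: (IHp z _ g AV_t) => //; rewrite eq_t.
Qed.

(** For disjoint views the agreement is void, and it is enough that the second one is nonempty. *)
Lemma gac_join R R' f : R \in symbols AV -> R' \in symbols AV ->
  map f (vtuple AV R) \in tuples C R ->
  exists2 g, map g (vtuple AV R') \in tuples C R' &
    forall y, y \in vtuple AV R -> y \in vtuple AV R' -> f y = g y.
Proof.
move=> AV_R AV_R' C_f; have [/hasP[x R'x Rx]|/hasPn disj] :=
  boolP (has (mem (vtuple AV R)) (vtuple AV R')).
  exact: gac_meet Rx R'x C_f.
have [g C_g] := gac_nonempty AV_R AV_R' C_f; exists g => // y Ry R'y.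
by have := disj y R'y; rewrite /= Ry.
Qed.

(** The last conclusion serves the recursion: an assigned variable has a single value left in its
    domain view, so [h] takes that value. *)
Lemma gac_extend X a : X \in O -> [:: a] \in tuples C (dom_view X) ->
  exists h, [/\ hom h A B, h X = a &
    forall Y, Y \in O -> [:: h Y] \in tuples C (dom_view Y)].
Proof.
move=> O_X C_a; have [[wfA' _ _ subA'] [k homk] _] := coreA.
have [_ [r joinr] covA' covHa] := projA.
have kA R t : t \in tuples A R -> map k t \in tuples A' (inl R) /\ map k t \in tuples A R.
  move=> A_t; have A'_t : map k t \in tuples A' (inl R).
    by apply: homk.2; rewrite tuples_union_inl.
  by split=> //; rewrite -(tuples_union_inl A (singletons O)); apply: subA'.
have kO Y : Y \in O -> k Y = Y /\ [:: Y] \in tuples A' (inr Y).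
  move=> O_Y; have A'_Y : map k [:: Y] \in tuples A' (inr Y).
    by apply: homk.2; rewrite tuples_union_inr mem_singletons O_Y eqxx.
  have := subA' _ _ A'_Y; rewrite tuples_union_inr mem_singletons => /andP[_ /eqP[kY]].
  by rewrite -{2 3}kY.
have domV Y : Y \in O -> dom_view Y \in symbols AV /\ vtuple AV (dom_view Y) = [:: Y].
  by move=> O_Y; apply: base_view; apply: domA.
have edge_view e : e \in edges Ha ->
    exists R, R \in symbols AV /\ forall x, x \in e -> x \in vtuple AV R.
  move=> /covHa[e' /hyper_edgeP[R [t [AV_t ->]]] /fsubsetP sub].
  have AV_R := tuples_symbols AV_t; exists R; split=> // x /sub; rewrite in_fset_of.
  (* A view has a single tuple, so the hyperedge that contains [e] is the set of variables of a
     view. *)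
  suff -> : vtuple AV R = t by [].
  have [/and3P[_ uniqAV _] _ /allP one _] := viewAV.
  case/tuplesP: AV_t => r0 r0_AV [<-]; rewrite /vtuple tuples_rel //.
  by move/eqP: (one _ r0_AV); case: (rtup r0) => [|t0 []] //= _; rewrite mem_seq1 => /eqP->.
(* Consistency on [e] is witnessed by any view that covers [e]; [gac_join] passes from one view to
   another, so the choice of the view does not matter. *)
pose Rl (e : {fset data}) (f : data -> data) := exists R g,
  [/\ R \in symbols AV, forall x, x \in e -> x \in vtuple AV R,
      map g (vtuple AV R) \in tuples C R & {in e, f =1 g}].
have [kX A'_X] := kO X O_X.
have [e0 e0_Ha /fsubsetP e0_X] := covA' _ (hyper_edge A'_X).
have {}e0_X : X \in e0 by apply: e0_X; rewrite in_fset_of mem_head.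
have [R0 [AV_R0 sub0]] := edge_view e0 e0_Ha.
have [AV_X eq_X] := domV X O_X.
(* The constant function represents the tuple [[:: a]] of the domain view of [X]. *)
have [|g0 C_g0 eq_g0] := gac_join (f := fun=> a) AV_X AV_R0; first by rewrite eq_X.
have [|||f eq_f Rl_f] := @join_tree_extend Ha r data Rl joinr _ _ e0 g0 e0_Ha.
- move=> e f g _ eq_fg [R [g1 [AV_R sub C_g eq_g]]]; exists R, g1; split=> // x e_x.
  by rewrite -eq_fg // eq_g.
- move=> e e' f e_Ha e'_Ha [R [g1 [AV_R sub C_g eq_g]]].
  have [R' [AV_R' sub']] := edge_view e' e'_Ha.
  have [g2 C_g2 eq_g2] := gac_join AV_R AV_R' C_g.
  exists g2; first by exists R', g2.
  move=> x; rewrite in_fsetI => /andP[e_x e'_x].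
  by rewrite eq_g // eq_g2 ?sub ?sub'.
- by exists R0, g0.
(* The symbols [R] and [R'] are independent: for [Y] in [O], the tuple of [A'] is that of the fresh
   symbol of [Y], whereas the view is the base view of [Dom Y]. *)
have fA' R R' t : t \in tuples A' R' -> t \in tuples A R -> map f t \in tuples C (Base R t).
  move=> A'_t A_t; have [e e_Ha /fsubsetP sub_e] := covA' _ (hyper_edge A'_t).
  have [R1 [g1 [AV_R1 sub1 C_g1 eq_g1]]] := Rl_f e e_Ha.
  have [AV_t eq_t] := base_view A_t.
  have [g2 C_g2 eq_g2] := gac_join AV_R1 AV_t C_g1.
  rewrite eq_t in C_g2 eq_g2; rewrite (_ : map f t = map g2 t) //.
  apply/eq_in_map => x t_x; have e_x: x \in e by apply: sub_e; rewrite in_fset_of.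
  by rewrite eq_g1 // eq_g2 // sub1.
have homA R t : t \in tuples A R -> map (f \o k) t \in tuples B R.
  move=> A_t; have [A'_kt A_kt] := kA R t A_t; rewrite map_comp.
  apply: (baseBV A_kt); apply: gac_sub; exact: fA' A'_kt A_kt.
exists (f \o k); split.
(* A variable is sent into the universe of [B] because it occurs in some tuple, which is sent into a
   relation of [B]. *)
- split=> // x /coverA[R [t [A_t t_x]]].
  by have [_] := wf_tuple wfB (homA R t A_t); apply; apply: map_f.
- rewrite /= kX eq_f // -eq_g0 ?sub0 //; by rewrite eq_X mem_head.
move=> Y O_Y; have [kY A'_Y] := kO Y O_Y.
by have := fA' (Dom Y) (inr Y) [:: Y] A'_Y (domA O_Y); rewrite /= kY.
Qed.
End GacExtend.

(** * Domain-restricted versions of instances *)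

Lemma mem_symbols_voc (S : eqType) (A : structure S) R :
  (R \in symbols A) = (R \in map fst (voc A)).
Proof. by rewrite /symbols /voc -map_comp. Qed.

Section Restrict.
Variables (A B : structure sym) (O : seq data) (c : seq nat).
Hypotheses (instAB : csp_instance A B) (uniqO : uniq O) (O_gt0 : 0 < size O).
Hypotheses (subO : {subset O <= univ A}) (colc : column_choice A B O c).

Let A1 := restrict_left A O.
Let B1 := restrict_right A B O c.
Let column X := nth [::] (columns A B X) (nth 0 c (index X O)).

Lemma wf_left : wf A.
Proof. by have [/andP[]] := instAB. Qed.

Lemma symbols_right : symbols B =i symbols A.
Proof.
by have [_ _ eqV] := instAB; move=> R; rewrite !mem_symbols_voc;
  apply/mapP/mapP => [] [x]; rewrite -?eqV => x_V ->; exists x; rewrite ?eqV // -eqV.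
Qed.

Lemma tuples_restrict_left R t : reflect
  (t \in tuples A R \/ exists X, [/\ X \in O, ~~ restricted A X, R = Dom X & t = [:: X]])
  (t \in tuples A1 R).
Proof.
apply: (iffP (tuplesP _ _ _)) => [[r]|].
  rewrite mem_cat => /orP[r_A|/mapP[X]].
    by move=> r_R; left; apply/tuplesP; exists r.
  rewrite mem_filter => /andP[nresX O_X ->] /= [<-]; rewrite mem_seq1 => /eqP->.
  by right; exists X.
case=> [/tuplesP[r r_A r_R]|[X [O_X nresX -> ->]]]; first by exists r; rewrite ?mem_cat ?r_A.
exists (Rel (Dom X) 1 [:: [:: X]]); last by rewrite mem_head.
by rewrite mem_cat; apply/orP; right; apply/mapP; exists X; rewrite // mem_filter nresX.
Qed.

Lemma tuples_restrict_right R t : reflect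
  (t \in tuples B R \/ exists X v,
     [/\ X \in O, ~~ restricted A X, R = Dom X, v \in column X & t = [:: v]])
  (t \in tuples B1 R).
Proof.
apply: (iffP (tuplesP _ _ _)) => [[r]|].
  rewrite mem_cat => /orP[r_B|/mapP[X]].
    by move=> r_R; left; apply/tuplesP; exists r.
  rewrite mem_filter => /andP[nresX O_X ->] /= [<-] /mapP[v]; rewrite mem_undup => col_v ->.
  by right; exists X, v.
case=> [/tuplesP[r r_B r_R]|[X [v [O_X nresX -> col_v ->]]]].
  by exists r; rewrite ?mem_cat ?r_B.
exists (Rel (Dom X) 1 [seq [:: w] | w <- undup (column X)]).
  by rewrite mem_cat; apply/orP; right; apply/mapP; exists X; rewrite // mem_filter nresX.
by split=> //; apply/mapP; exists v; rewrite ?mem_undup.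
Qed.

Lemma dom_restrict_left X : X \in O -> [:: X] \in tuples A1 (Dom X).
Proof.
move=> O_X; apply/tuples_restrict_left; have [/mapP[r r_A r_X]|nresX] := boolP (restricted A X).
  have [/andP[_ /allP domA] _ _] := instAB.
  have := domA r r_A; rewrite -r_X => /eqP eq_r; left; apply/tuplesP; exists r => //.
  by rewrite eq_r mem_head.
by right; exists X.
Qed.

Lemma column_occurs X : X \in O -> exists R t k,
  [/\ t \in tuples A R, k < size t, nth Leaf t k = X &
      column X = [seq nth Leaf b k | b <- tuples B R]].
Proof.
have [_ lt_c] := colc => /lt_c/(mem_nth [::]).
case/flatten_mapP => r r_A /flatten_mapP[t r_t] /mapP[k].
rewrite mem_filter mem_iota add0n /= => /andP[/eqP t_k lt_k] eq_col.
by exists (rsym r), t, k; split=> //; apply/tuplesP; exists r.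
Qed.

Lemma size_right_tuple R t b : t \in tuples A R -> b \in tuples B R -> size b = size t.
Proof.
have [_ wfB eqV] := instAB; move=> /(tuples_voc wf_left) A_t /(tuples_voc wfB).
by rewrite -eqV => /(voc_inj wf_left A_t).
Qed.

Lemma csp_instance_restrict : csp_instance A1 B1.
Proof.
have [/andP[/and3P[uA sA rA] dA] /and3P[uB sB rB] eqV] := instAB.
have symbols_new : [seq rsym r | r <- [seq Rel (Dom X) 1 [:: [:: X]] | X <- O & ~~ restricted A X]]
    = [seq Dom X | X <- O & ~~ restricted A X] by rewrite -map_comp.
have uniq_new : uniq [seq Dom X | X <- O & ~~ restricted A X].
  by rewrite map_inj_uniq ?filter_uniq // => X Y [].
have new_old R : R \in [seq Dom X | X <- O & ~~ restricted A X] -> R \notin symbols A.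
  by case/mapP=> X; rewrite mem_filter => /andP[? _] ->.
split.
- apply/andP; split.
    apply/and3P; split=> //.
      rewrite /symbols /= map_cat symbols_new cat_uniq -/(symbols A) sA uniq_new andbT /=.
      by apply/hasPn => R /new_old.
    rewrite all_cat rA; apply/allP => r /mapP[X]; rewrite mem_filter => /andP[_ O_X] ->.
    by rewrite /wf_rel /= subO.
  rewrite all_cat dA; apply/allP => r /mapP[X _ ->] /=; exact: eqxx.
- apply/and3P; split=> //.
    rewrite /symbols /= map_cat -map_comp cat_uniq -/(symbols B) sB uniq_new andbT /=.
    by apply/hasPn => R /new_old /=; rewrite symbols_right.
  rewrite all_cat rB; apply/allP => r /mapP[X]; rewrite mem_filter => /andP[_ O_X] ->.
  rewrite /wf_rel /= map_inj_uniq ?undup_uniq /=; last by move=> v w [].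
  apply/allP => _ /mapP[v + ->] /=; rewrite mem_undup andbT.
  have [R [t [k [A_t lt_k _ eq_col]]]] := column_occurs O_X.
  rewrite -/(column X) eq_col => /mapP[b B_b ->].
  have [_ wfB _] := instAB; have [_ sub] := wf_tuple wfB B_b; apply: sub.
  by apply: mem_nth; rewrite (size_right_tuple A_t B_b).
by move=> x; rewrite /voc !map_cat !mem_cat -/(voc A) -/(voc B) eqV -!map_comp.
Qed.

(** Any column of [X] contains [h X], because [h] maps the tuple in which [X] occurs into the
    constraint relation. So the added constraints exclude no homomorphism, whichever columns are
    chosen. *)
Lemma hom_restrict h : hom h A1 B1 <-> hom h A B.
Proof.
split=> [] [hU hT]; split=> // R t.
  move=> A_t; have A1_t : t \in tuples A1 R by apply/tuples_restrict_left; left.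
  have /tuples_restrict_right[//|[X [v [_ nresX eqR _ _]]]] := hT R t A1_t.
  by case/negP: nresX; rewrite /restricted -eqR; apply: tuples_symbols A_t.
case/tuples_restrict_left => [/hT B_t|[X [O_X nresX -> ->]]].
  by apply/tuples_restrict_right; left.
apply/tuples_restrict_right; right; exists X, (h X); split=> //.
have [R' [t' [k [A_t' lt_k t'_k ->]]]] := column_occurs O_X.
by apply/mapP; exists (map h t'); rewrite ?hT // (nth_map Leaf) // t'_k.
Qed.

Lemma solution_restrict s : solution A1 B1 O s <-> solution A B O s.
Proof. by split=> [] [h /hom_restrict homh ->]; exists h => //; apply/hom_restrict. Qed.

Lemma connected_restrict : connected A -> connected A1.
Proof.
move=> connA x y Ux Uy; have [p pathp lastp] := @connA x y Ux Uy.
exists p => //; apply: sub_path pathp => u v /hasP[e /hyper_edgeP[R [t [A_t ->]]] e_uv].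
apply/hasP; exists (fset_of t) => //; apply: (@hyper_edge _ A1 R).
by apply/tuples_restrict_left; left.
Qed.

(** A connected structure may consist of one variable without any tuple. A path to a variable of [O]
    either starts with a hyperedge that contains [x], or is empty, and then [x] is covered by its
    domain constraint. *)
Lemma cover_restrict x : connected A -> x \in univ A1 ->
  exists R t, t \in tuples A1 R /\ x \in t.
Proof.
move=> connA A_x; case: O O_gt0 dom_restrict_left subO => // X O' _ domX sub.
have [|| p pathp lastp] := connected_restrict connA (x := x) (y := X); rewrite ?in_fset_of //.
  by apply: sub; rewrite mem_head.
case: p pathp lastp => [_ /= ->|y p /= /andP[/hasP[e /hyper_edgeP[R [t [A_t ->]]]] + _] _].
  by exists (Dom X), [:: X]; rewrite domX !mem_head.
by rewrite !in_fset_of => /andP[t_x _]; exists R, t.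
Qed.
End Restrict.

(** * The search tree of the algorithm *)

Lemma uniq_flatten_map (T U : eqType) (F : T -> seq U) l : uniq l ->
  {in l, forall a, uniq (F a)} ->
  {in l &, forall a b x, x \in F a -> x \in F b -> a = b} -> uniq (flatten (map F l)).
Proof.
elim: l => //= a l IHl /andP[l_a uniq_l] uniqF disjF.
rewrite cat_uniq uniqF ?mem_head //= IHl //; first last.
- by move=> b c l_b l_c; apply: disjF; rewrite in_cons ?l_b ?l_c orbT.
- by move=> b l_b; apply: uniqF; rewrite in_cons l_b orbT.
rewrite andbT; apply/hasPn => x /flatten_mapP[b l_b Fb_x]; apply: contra l_a => Fa_x.
by rewrite (disjF a b _ _ x) // in_cons ?eqxx // l_b orbT.
Qed.

Lemma symbols_prune AV BV : symbols (prune AV BV) = symbols BV.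
Proof. by rewrite /symbols -map_comp. Qed.

Lemma wf_prune AV BV : wf BV -> wf (prune AV BV).
Proof.
case/and3P=> uU uS /allP wfr; apply/and3P; split=> //; first by rewrite symbols_prune.
apply/allP => _ /mapP[r /wfr /and3P[ar ut /allP wft] ->]; apply/and3P; split=> //=.
  exact: filter_uniq.
by apply/allP => t; rewrite mem_filter => /andP[_ /wft].
Qed.

Lemma voc_prune AV BV : voc (prune AV BV) = voc BV.
Proof. by rewrite /voc -map_comp. Qed.

Lemma gac_ind (Q : structure vsym -> Prop) AV BV :
  (forall B, Q B -> Q (prune AV B)) -> Q BV -> Q (gac AV BV).
Proof. by move=> ind Q0; rewrite /gac; elim: (sumn _) => //= n; apply: ind. Qed.

(** The tuples that one map induces in all views support each other, so pruning deletes none of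
    them. *)
Lemma gac_hom AV BV (h : data -> data) :
  (forall R, R \in symbols AV -> map h (vtuple AV R) \in tuples BV R) ->
  forall R, R \in symbols AV -> map h (vtuple AV R) \in tuples (gac AV BV) R.
Proof.
apply: (gac_ind (Q := fun B => forall R, R \in symbols AV ->
  map h (vtuple AV R) \in tuples B R)) => {}BV hB R AV_R.
rewrite mem_prune hB //=; apply/allP => R' AV_R'; apply/implyP => _.
by apply/hasP; exists (map h (vtuple AV R')); [apply: hB | apply: agree_map].
Qed.

Lemma tuples_set_neq BV R bs R' : R' != R ->
  tuples (set_tuples BV R bs) R' = tuples BV R'.
Proof.
move=> neq; rewrite /tuples /=; elim: (rels BV) => //= r s IHs.
case: (eqVneq (rsym r) R) => [->|_] /=; last by case: ifP => //= _; rewrite IHs.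
by rewrite eq_sym (negPf neq).
Qed.

Lemma tuples_set_eq BV R bs : uniq (symbols BV) -> R \in symbols BV ->
  tuples (set_tuples BV R bs) R = bs.
Proof.
rewrite /tuples /symbols /=; elim: (rels BV) => //= r s IHs /andP[s_r uniq_s].
rewrite in_cons; have [eqR _|neq /= s_R] := eqVneq R (rsym r); last first.
  by do 2?[rewrite [rsym r == R]eq_sym (negPf neq) /=]; rewrite IHs.
subst R; rewrite !eqxx /= [X in bs ++ X](_ : _ = [::]) ?cats0 //.
elim: s s_r {IHs uniq_s} => //= r' s IHs; rewrite in_cons negb_or eq_sym => /andP[neq s_r].
by do 2?[rewrite (negPf neq) /=]; rewrite IHs.
Qed.

Lemma esize_seq1 (T : eqType) {eT : encoding T} (x : T) s :
  x \in s -> esize [:: x] <= esize s.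
Proof.
elim: s => //= y s IHs; rewrite in_cons !esize_cons esize_nil => /orP[/eqP->|/IHs].
  have: 0 < esize s by exact: esize_gt0.
  by lia.
by rewrite esize_cons esize_nil; lia.
Qed.

Lemma leq_esize_seq (T : eqType) {eT : encoding T} (s : seq T) m :
  {in s, forall x, esize x < m} -> esize s <= size s * m + 1.
Proof.
elim: s => [|x s IHs] lt_m; first by rewrite esize_nil.
have := IHs (fun y s_y => lt_m y (@mem_behead _ (x :: s) y s_y)).
by have := lt_m x (mem_head _ _); rewrite esize_cons [size (x :: s)]/= mulSn; lia.
Qed.

Lemma size_tuples (BV : structure vsym) R : uniq (symbols BV) -> size
    (tuples BV R) <= esize BV.
Proof.
move=> uniqS; have [/mapP[r r_B ->]|notR] := boolP (R \in symbols BV).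
  rewrite tuples_rel //; apply: leq_trans (ltnW (size_esize (rtup r))) _.
  apply: leq_trans (ltnW (esize_rtup_lt r)) _.
  exact: leq_trans (ltnW (esize_mem r_B)) (ltnW (esize_rels_lt BV)).
by case E: (tuples BV R) => [|t ts] //; case/negP: notR; apply: (@tuples_symbols _ _ _ t);
   rewrite E mem_head.
Qed.

Section Search.
Variables (A B : structure sym) (O : seq data) (AV BV0 : structure vsym).
Hypotheses (viewAV : view_structure A AV) (legalBV0 : legal AV BV0 A B).
Hypothesis domA : forall X, X \in O -> [:: X] \in tuples A (Dom X).
(** All that the search uses of connectedness and of the tree projection. *)
Hypothesis extend : forall BV X a, wf BV -> voc BV =i voc AV ->
  (forall R t, t \in tuples A R -> {subset tuples BV (Base R t) <= tuples B R}) ->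
  X \in O -> [:: a] \in tuples (gac AV BV) (dom_view X) ->
  exists h, [/\ hom h A B, h X = a &
    forall Y, Y \in O -> [:: h Y] \in tuples (gac AV BV) (dom_view Y)].

(* The variables Ys have got the values pre. *)
Record node (Ys Xs : seq data) (BV : structure vsym) (pre : seq data) : Prop := {
  node_vars : Ys ++ Xs = O;
  node_wf : wf BV;
  node_voc : voc BV =i voc AV;
  node_univ : univ BV = univ BV0;
  node_pre : {subset pre <= univ BV0};
  node_size : size pre = size Ys;
  node_esize : esize BV <= esize BV0;
  node_hom : forall h R, hom h A B -> map h Ys = pre -> R \in symbols AV ->
    map h (vtuple AV R) \in tuples BV R;
  node_base : forall R t, t \in tuples A R -> {subset tuples BV (Base R t) <= tuples B R};
  node_fix : forall h, (forall Y, Y \in Ys -> [:: h Y] \in tuples BV (dom_view Y)) ->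
    map h Ys = pre }.

Lemma node_root : node [::] O BV0 [::].
Proof. by case: legalBV0 => wf0 voc0 hom0 base0; split=> // h R homh _ /hom0; apply. Qed.

Lemma dom_viewP X : X \in O ->
  dom_view X \in symbols AV /\ vtuple AV (dom_view X) = [:: X].
Proof. by have [_ _ _ base] := viewAV => O_X; apply: base; apply: domA. Qed.

Lemma gac_dom BV X b : X \in O -> wf BV -> voc BV =i voc AV ->
  b \in tuples (gac AV BV) (dom_view X) -> b = [:: head Leaf b].
Proof.
move=> O_X wfBV vocBV /gac_sub BV_b; have [AV_X eq_X] := dom_viewP O_X.
have := size_view viewAV wfBV vocBV AV_X BV_b; rewrite eq_X.
by case: b {BV_b} => [|x []].
Qed.

Lemma mem_active BV X a : X \in O -> wf BV -> voc BV =i voc AV ->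
  (a \in active AV BV X) = ([:: a] \in tuples (gac AV BV) (dom_view X)).
Proof.
move=> O_X wfBV vocBV; apply/mapP/idP => [[b C_b ->]|C_a].
  by rewrite -(gac_dom O_X wfBV vocBV C_b).
by exists [:: a].
Qed.

Lemma uniq_tuples (BV : structure vsym) R : wf BV -> uniq (tuples BV R).
Proof.
case/and3P=> _ uniqS /allP wfr; have [/mapP[r r_B ->]|notR] := boolP (R \in symbols BV).
  by rewrite tuples_rel //; case/and3P: (wfr r r_B).
by case E: (tuples BV R) => [|t ts] //; case/negP: notR; apply: (@tuples_symbols _ _ _ t);
   rewrite E mem_head.
Qed.

Lemma wf_gac BV : wf BV -> wf (gac AV BV).
Proof. by apply: (gac_ind (Q := fun B' => wf B')) => B'; apply: wf_prune. Qed.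

Lemma voc_gac BV : voc (gac AV BV) = voc BV.
Proof. by apply: (gac_ind (Q := fun B' => voc B' = voc BV)) => // B'; rewrite voc_prune. Qed.

Lemma univ_gac BV : univ (gac AV BV) = univ BV.
Proof. exact: (gac_ind (Q := fun B' => univ B' = univ BV)). Qed.

Lemma uniq_active BV X : X \in O -> wf BV -> voc BV =i voc AV -> uniq (active AV BV X).
Proof.
move=> O_X wfBV vocBV; rewrite map_inj_in_uniq; first exact: uniq_tuples (wf_gac wfBV).
by move=> b b' /(gac_dom O_X wfBV vocBV) {2}-> /(gac_dom O_X wfBV vocBV) {2}-> ->.
Qed.

(** From left to right, [extend] gives a homomorphism that also stays in the domain views of [Ys],
    where its values are [pre] by [node_fix]. From right to left, GAC keeps the restrictions of
    every homomorphism through [pre]. *)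
Lemma active_node Ys X Xs BV pre a : node Ys (X :: Xs) BV pre ->
  (a \in active AV BV X) <-> exists h, [/\ hom h A B, map h Ys = pre & h X = a].
Proof.
case=> vars wfBV vocBV _ _ _ _ homBV baseBV fixBV.
have O_X : X \in O by rewrite -vars mem_cat mem_head orbT.
rewrite mem_active //; split=> [/(extend wfBV vocBV baseBV O_X)[h [homh hX domh]]|].
  exists h; split=> //; apply: fixBV => Y Ys_Y; apply: gac_sub (domh Y _).
  by rewrite -vars mem_cat Ys_Y.
case=> h [homh hYs <-]; have [AV_X eq_X] := dom_viewP O_X.
have := gac_hom (fun R => homBV h R homh hYs) AV_X; by rewrite eq_X.
Qed.

(** An assignment excludes only homomorphisms with another value at [X], and what remains in the
    domain view of [X] forces the value [a]; so [node_hom] and [node_fix] pass to the longer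
    tuple. *)
Lemma node_assign Ys X Xs BV pre a : node Ys (X :: Xs) BV pre -> a \in active AV BV X ->
  node (rcons Ys X) Xs (assign AV BV X a) (rcons pre a).
Proof.
case=> vars wfBV vocBV univBV subpre sizepre sizeBV homBV baseBV fixBV act_a.
have O_X : X \in O by rewrite -vars mem_cat mem_head orbT.
have [AV_X eq_X] := dom_viewP O_X.
move: act_a; rewrite mem_active // => C_a.
have wfC := wf_gac wfBV; have C_X := tuples_symbols C_a.
have uniqC : uniq (symbols (gac AV BV)) by case/and3P: wfC.
have relC r : r \in rels (gac AV BV) -> rsym r = dom_view X -> [:: a] \in rtup r.
  by move=> r_C r_X; rewrite -(tuples_rel uniqC r_C) r_X.
have symC : symbols (assign AV BV X a) = symbols (gac AV BV).
  by rewrite /symbols -map_comp; apply: eq_map => r /=; case: eqP.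
have tupC R t : t \in tuples (assign AV BV X a) R -> t \in tuples (gac AV BV) R.
  have [->|neq] := eqVneq R (dom_view X); last by rewrite tuples_set_neq.
  by rewrite tuples_set_eq // mem_seq1 => /eqP->.
split.
- by rewrite cat_rcons.
- case/and3P: (wfC) => uU uS /allP wfr; apply/and3P; split=> //; first by rewrite symC.
  apply/allP => _ /mapP[r r_C ->]; case: eqP => [r_X|_]; last exact: wfr.
  have /and3P[ar _ /allP wft] := wfr r r_C; apply/and3P; split=> //=.
  by rewrite andbT; have := wft _ (relC r r_C r_X).
- by move=> x; rewrite -vocBV -(voc_gac BV) /voc -map_comp; congr (x \in _); apply: eq_map => r /=;
    case: eqP => // ->.
- by rewrite /= univ_gac.
- move=> x; rewrite mem_rcons in_cons => /orP[/eqP->|/subpre //].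
  by have [_] := wf_tuple wfC C_a; rewrite univ_gac univBV; apply; apply: mem_head.
- by rewrite !size_rcons sizepre.
- apply: leq_trans (leq_trans (esize_gac AV BV) sizeBV); apply: leq_esize_str => //=.
  apply: leq_esize_map => r r_C; case: eqP => [r_X|_] //; apply: leq_esize_rel => //=.
  exact: esize_seq1 (relC r r_C r_X).
- move=> h R homh; rewrite map_rcons => /rcons_inj[hYs hX] AV_R.
  have hC := gac_hom (fun R' => homBV h R' homh hYs) AV_R.
  have [eqR|neq] := eqVneq R (dom_view X); last by rewrite tuples_set_neq.
  by rewrite eqR tuples_set_eq // eq_X /= hX mem_head.
- by move=> R t A_t b /tupC/gac_sub; apply: baseBV.
move=> h domh; rewrite map_rcons; congr rcons.
  apply: fixBV => Y Ys_Y; apply: gac_sub (tupC _ _ (domh Y _)).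
  by rewrite mem_rcons in_cons Ys_Y orbT.
have := domh X; rewrite mem_rcons mem_head tuples_set_eq // mem_seq1.
by move=> /(_ isT)/eqP[].
Qed.

(** A leaf outputs [pre] unconditionally, hence the hypothesis that some homomorphism takes these
    values; for subcalls [active_node] supplies it. *)
Lemma mem_enumerate Ys Xs BV pre : node Ys Xs BV pre ->
  (exists2 h, hom h A B & map h Ys = pre) -> forall s,
  s \in enumerate AV Xs BV pre <-> exists h, [/\ hom h A B, map h Ys = pre & s = map h O].
Proof.
elim: Xs Ys BV pre => [|X Xs IHXs] Ys BV pre nodeN [h0 homh0 h0Ys] s.
  have := node_vars nodeN; rewrite cats0 => <-; rewrite mem_seq1; split=> [/eqP->|].
    by exists h0; rewrite h0Ys.
  by case=> h [_ -> ->].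
rewrite enumerate_cons; split.
  case/flatten_mapP => a act_a; have nodea := node_assign nodeN act_a.
  have [h [homh hYs hX]] := (active_node a nodeN).1 act_a.
  rewrite (IHXs _ _ _ nodea) => [[h' [homh' + ->]]|].
    by rewrite map_rcons => /rcons_inj[h'Ys _]; exists h'.
  by exists h; rewrite // map_rcons hYs hX.
case=> h [homh hYs ->]; have act_h : h X \in active AV BV X.
  by apply/(active_node _ nodeN); exists h.
apply/flatten_mapP; exists (h X) => //; rewrite (IHXs _ _ _ (node_assign nodeN act_h)).
  by exists h; rewrite map_rcons hYs.
by exists h; rewrite ?map_rcons ?hYs.
Qed.

Lemma uniq_enumerate Ys Xs BV pre : node Ys Xs BV pre ->
  (exists2 h, hom h A B & map h Ys = pre) -> uniq (enumerate AV Xs BV pre).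
Proof.
elim: Xs Ys BV pre => [|X Xs IHXs] Ys BV pre nodeN _ //.
have O_X : X \in O by rewrite -(node_vars nodeN) mem_cat mem_head orbT.
have some a : a \in active AV BV X ->
    exists2 h, hom h A B & map h (rcons Ys X) = rcons pre a.
  move=> /(active_node _ nodeN)[h [homh hYs hX]]; exists h => //.
  by rewrite map_rcons hYs hX.
rewrite enumerate_cons; apply: uniq_flatten_map.
- exact: uniq_active O_X (node_wf nodeN) (node_voc nodeN).
- by move=> a act_a; apply: IHXs (node_assign nodeN act_a) (some a act_a).
(* A tuple output below [a] comes from a homomorphism with value [a] at [X], so the tuple determines
   the sibling. *)
move=> a b act_a act_b s.
rewrite (mem_enumerate (node_assign nodeN act_a) (some a act_a)).
case=> h [_ + ->]; rewrite map_rcons => /rcons_inj[_ <-].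
rewrite (mem_enumerate (node_assign nodeN act_b) (some b act_b)).
case=> h' [_ + /eq_in_map eq_h]; rewrite map_rcons => /rcons_inj[_ <-].
exact: eq_h.
Qed.

(** The product bounds [pre]: it has at most as many entries as [O], and each of them lies in the
    universe of [BV0], so its code is smaller than that of [BV0]. *)
Lemma esize_node Ys Xs BV pre : node Ys Xs BV pre ->
  esize (Xs, (BV, pre)) <= esize O * esize BV0 + esize O + esize BV0 + 5.
Proof.
case=> vars _ _ _ subpre sizepre sizeBV _ _ _.
have := @esize_catl data enc_data Ys Xs; rewrite vars !esize_pair.
have : 0 < esize Ys by exact: esize_gt0.
have : esize pre <= size pre * esize BV0 + 1.
  apply: leq_esize_seq => x /subpre/esize_mem/ltn_trans; apply; exact: esize_univ_lt.
have : size pre <= esize O.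
  rewrite sizepre; apply: leq_trans (ltnW (size_esize O)).
  by rewrite -vars size_cat leq_addr.
by move: sizeBV; nia.
Qed.

Lemma tame_node Ys Xs BV pre : node Ys Xs BV pre ->
  (exists2 h, hom h A B & map h Ys = pre) ->
  tame AV (esize O * esize BV0 + esize O + esize BV0 + 5) (esize BV0) Xs BV pre.
Proof.
elim: Xs Ys BV pre => [|X Xs IHXs] Ys BV pre nodeN [h homh hYs].
  by split; first exact: esize_node nodeN.
split; first exact: esize_node nodeN.
split=> [|a act_a].
  have act_h : h X \in active AV BV X by apply/(active_node _ nodeN); exists h.
  apply/andP; split; first by case: (active AV BV X) act_h.
  rewrite size_map; apply: leq_trans (size_tuples _ _) _.
    by case/and3P: (wf_gac (node_wf nodeN)).
  exact: leq_trans (esize_gac AV BV) (node_esize nodeN).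
have [h' [homh' h'Ys h'X]] := (active_node a nodeN).1 act_a.
apply: IHXs (node_assign nodeN act_a) _.
by exists h'; rewrite // map_rcons h'Ys h'X.
Qed.

End Search.

(** * The program *)

Notation instance := (structure sym * structure sym * seq data)%type.

Lemma polytime_enc T U {eT : encoding T} {eU : encoding U} eT' eU' D (f : T -> U) :
  eT' =1 enc -> eU' =1 enc -> polytime eT' eU' D f -> ptime_on D f.
Proof.
move=> eqT eqU [P [p run]]; apply: polytime_on; exists P, p => x /run[k].
by rewrite eqT eqU; exists k.
Qed.

Lemma enc_cspE AB : of_csp AB = enc AB.
Proof. by case: AB => A B; rewrite /of_csp -!enc_strE. Qed.

Lemma enc_ecspE A B O : of_ecsp A B O = enc ((A, B), O).
Proof. by rewrite /of_ecsp enc_cspE -enc_seq_data. Qed.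

Lemma enc_inputE A B O c : input A B O c = enc (((A, B), O), c).
Proof. by rewrite /input enc_ecspE. Qed.

Definition admissible (x : instance * seq nat) : Prop :=
  ecsp_instance x.1.1.1 x.1.1.2 x.1.2 /\ column_choice x.1.1.1 x.1.1.2 x.1.2 x.2.

Definition start (DM : decomposition_method) (x : instance * seq nat) :
    structure vsym * seq task :=
  let A1 := restrict_left x.1.1.1 x.1.2 in
  let B1 := restrict_right x.1.1.1 x.1.1.2 x.1.2 x.2 in
  (lDM DM A1, [:: (x.1.2, (rDM DM A1 B1, [::]))]).

(** The two functions of [DM] are applied to the restricted instance; their time bounds hold there
    because it is again a CSP instance. *)
Lemma ptime_start DM : ptime_on admissible (start DM).
Proof.
have inst x : admissible x -> csp_instance (restrict_left x.1.1.1 x.1.2)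
    (restrict_right x.1.1.1 x.1.1.2 x.1.2 x.2).
  by case: x => [[[A B] O] c] [[instAB uO _ sub] colc]; apply: csp_instance_restrict.
have ptA : ptime (fun x : instance * seq nat => restrict_left x.1.1.1 x.1.2).
  by apply: ptime_restrict_left; ptime_tac.
have ptB : ptime (fun x : instance * seq nat => restrict_right x.1.1.1 x.1.1.2 x.1.2 x.2).
  by apply: ptime_restrict_right; ptime_tac.
have ptl : ptime_on admissible (fun x => lDM DM (restrict_left x.1.1.1 x.1.2)).
  apply: (ptime_on_comp (D' := left_hand)) (ptime_onW _ ptA) _.
    by move=> x /inst[].
  by apply: polytime_enc (lDM_polytime DM) => A; rewrite -enc_strE.
have ptr : ptime_on admissible (fun x => rDM DM (restrict_left x.1.1.1 x.1.2)
    (restrict_right x.1.1.1 x.1.1.2 x.1.2 x.2)).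
  apply: (ptime_on_comp (D' := fun AB => csp_instance AB.1 AB.2)
    (f := fun x : instance * seq nat => (restrict_left x.1.1.1 x.1.2,
       restrict_right x.1.1.1 x.1.1.2 x.1.2 x.2)) (h := fun AB => rDM DM AB.1 AB.2)) => //.
    by apply: ptime_onW; apply: ptime_pair.
  by apply: polytime_enc (rDM_polytime DM) => AB; rewrite -?enc_strE ?enc_cspE.
apply: (ptime_on_comp (D' := fun=> True) (h := fun y : structure vsym * (seq data * structure vsym) =>
  (y.1, [:: (y.2.1, (y.2.2, Nil data))]))
  (f := fun x => (lDM DM (restrict_left x.1.1.1 x.1.2), (x.1.2,
    rDM DM (restrict_left x.1.1.1 x.1.2) (restrict_right x.1.1.1 x.1.1.2 x.1.2 x.2))))) => //.
  apply: ptime_on_pair => //; apply: ptime_on_pair => //.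
  by apply: ptime_onW; ptime_tac.
by rewrite -/(ptime _); ptime_tac.
Qed.

(** The delay is measured in the size of the instance, but the program also reads the choice of
    columns. An entry of [c] is below the number of columns of its variable, so even its unary code
    is polynomial in the instance. *)
Lemma pbounded_input : exists2 N : instance -> nat, pbounded N &
  forall x, admissible x -> esize x <= N x.1.
Proof.
have [q le_q] : pbounded (fun y : structure sym * structure sym * data =>
    esize (columns y.1.1 y.1.2 y.2)).
  by apply: pbounded_esize; apply: ptime_columns; ptime_tac.
exists (fun y => esize y + (esize y * (2 * q.[esize y]%R + 2) + 1) + 1).
  have bq : pbounded (fun y : instance => q.[esize y]%R) by exists q.
  have b1 (n : nat) : pbounded (fun _ : instance => n) by exact: pbounded_const.
  have bs : pbounded (fun y : instance => esize y) by exact: pbounded_size.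
  apply: (pboundedD _ (b1 1)); apply: (pboundedD bs); apply: (pboundedD _ (b1 1)).
  by apply: (pboundedM bs); apply: (pboundedD _ (b1 2)); apply: (pboundedM (b1 2)).
case=> [[[A B] O] c] [/= [_ uniqO _ _] [size_c lt_c]].
set n := esize ((A, B), O).
have le_c : esize c <= size c * (2 * q.[n]%R + 2) + 1.
  apply: leq_esize_seq => k c_k; rewrite esize_nat.
  (* [O] has no repetitions, so a position in [c] is the index of the variable at that position of
     [O]. *)
  have [X [O_X]] : exists X : data, X \in O /\ k = nth 0 c (index X O).
    exists (nth Leaf O (index k c)); have lt_k : index k c < size O by rewrite -size_c index_mem.
    by rewrite mem_nth // index_uniq ?nth_index.
  have := lt_c X O_X => /[swap] <- lt_k.
  have le_n : esize ((A, B), X) <= n.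
    have : esize X < esize O by exact: esize_mem.
    by rewrite /n !esize_pair; lia.
  have := leq_trans (size_esize _) (leq_trans (le_q ((A, B), X)) (leq_horner q le_n)).
  by move=> /= lt_col; lia.
have le_O : size c <= n.
  have : size O < esize O by exact: size_esize.
  by rewrite size_c /n !esize_pair; lia.
by rewrite esize_pair -/n; move: le_c le_O; nia.
Qed.

(** * The run on a tp-covered instance *)

Section Run.
Variables (DM : decomposition_method) (A B : structure sym) (O : seq data) (c : seq nat).
Hypotheses (instAB : csp_instance A B) (uniqO : uniq O) (O_gt0 : 0 < size O).
Hypotheses (subO : {subset O <= univ A}) (colc : column_choice A B O c).
Hypotheses (connA : connected A) (tpA : tp_covered DM (restrict_left A O) O).

Let A1 := restrict_left A O.
Let B1 := restrict_right A B O c.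
Let AV := lDM DM A1.
Let BV := rDM DM A1 B1.

Let inst1 : csp_instance A1 B1.
Proof. exact: csp_instance_restrict. Qed.

Let viewAV : view_structure A1 AV.
Proof. by apply: lDM_view; case: inst1. Qed.

Let legalBV : legal AV BV A1 B1.
Proof. exact: rDM_legal. Qed.

Let domA1 X : X \in O -> [:: X] \in tuples A1 (Dom X).
Proof. exact: (dom_restrict_left instAB). Qed.

Let extend BV' X a : wf BV' -> voc BV' =i voc AV ->
  (forall R t, t \in tuples A1 R -> {subset tuples BV' (Base R t) <= tuples B1 R}) ->
  X \in O -> [:: a] \in tuples (gac AV BV') (dom_view X) ->
  exists h, [/\ hom h A1 B1, h X = a &
    forall Y, Y \in O -> [:: h Y] \in tuples (gac AV BV') (dom_view Y)].
Proof.
have [A' coreA [Ha projA]] := tpA; have [_ wfB _] := inst1.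
move=> wfBV vocBV baseBV; apply: (gac_extend viewAV wfB wfBV vocBV baseBV _ _ domA1 coreA projA).
  exact: (connected_restrict (O := O)).
by move=> x A_x; apply: (cover_restrict instAB O_gt0 subO).
Qed.

Let root : node A1 B1 O AV BV [::] O BV [::].
Proof. exact: node_root. Qed.

Let OE : O = head Leaf O :: behead O.
Proof. by case: (O) O_gt0. Qed.

Lemma active_root a : a \in active AV BV (head Leaf O) <->
  exists2 h, hom h A1 B1 & h (head Leaf O) = a.
Proof.
have nodeO : node A1 B1 O AV BV [::] (head Leaf O :: behead O) BV [::] by rewrite -OE.
rewrite (active_node viewAV domA1 extend a nodeO).
by split=> [[h [homh _ hX]]|[h homh hX]]; exists h.
Qed.

(** An active value of the first variable already extends to a homomorphism, so the absence of
    solutions shows at the first call. *)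
Lemma hom_or_inactive :
  (exists h, hom h A1 B1) \/ active AV BV (head Leaf O) = [::].
Proof.
case E: (active AV BV (head Leaf O)) => [|a s]; [by right | left].
by have [|h homh _] := (active_root a).1 _; rewrite ?E ?mem_head //; exists h.
Qed.

Lemma Propagate_enumerate : Propagate AV O BV [::] = enumerate AV O BV [::].
Proof. by rewrite /enumerate; case: (O) O_gt0. Qed.

Lemma uniq_Propagate : uniq (Propagate AV O BV [::]).
Proof.
rewrite Propagate_enumerate; have [[h homh]|inactive] := hom_or_inactive.
  by apply: (uniq_enumerate viewAV domA1 extend root); exists h.
by rewrite OE enumerate_cons inactive.
Qed.

Lemma mem_Propagate s : s \in Propagate AV O BV [::] <-> solution A B O s.
Proof.
rewrite -(solution_restrict colc) Propagate_enumerate.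
have [[h homh]|inactive] := hom_or_inactive.
  rewrite (mem_enumerate viewAV domA1 extend root); last by exists h.
  by split=> [[h' [homh' _ ->]]|[h' homh' ->]]; exists h'.
rewrite [in enumerate _ _]OE enumerate_cons inactive; split=> // -[h homh _].
have : h (head Leaf O) \in active AV BV (head Leaf O) by apply/active_root; exists h.
by rewrite inactive.
Qed.

Lemma tame_root : (exists s, solution A B O s) ->
  tame AV (esize O * esize BV + esize O + esize BV + 5) (esize BV) O BV [::].
Proof.
case=> _ [h /(hom_restrict colc) homh _].
by apply: (tame_node viewAV domA1 extend root); exists h.
Qed.

End Run.

Theorem theorem5 (DM : decomposition_method) :
  exists2 P : prog, implements P DM &
  exists p : {poly nat},
  forall (A : structure sym) (O : seq data),
    left_hand A -> connected A ->
    uniq O -> 0 < size O -> {subset O <= univ A} ->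
    tp_covered DM (restrict_left A O) O ->
  forall (B : structure sym) (c : seq nat),
    csp_instance A B -> column_choice A B O c ->
    runs_WPD P p A B O c.
Proof.
have [P0 [t0 [[q0 bt0] run0]]] := ptime_start DM.
have [P1 [t1 [[q1 bt1] run1']]] := ptime_expand.
have run1 y : computes P1 q1.[esize y]%R (enc y) (enc (expand y)).
  exact: computes_le (bt1 y) (run1' y I).
have [N bN le_N] := pbounded_input.
exists (pSeq P0 (loop P1)).
  move=> A B O c instO colc.
  have [k _ runk] := run0 (((A, B), O), c) (conj instO colc).
  have [tr [st out _]] := steps_task run1 (lDM DM (restrict_left A O)) O
    (rDM DM (restrict_left A O) (restrict_right A B O c)) [::] [::].
  have [l _ stop] := loop_stop P1 q1 (lDM DM (restrict_left A O)).
  exists (ticks (dsize (input A B O c)) ++ ticks k ++ (tr ++ ticks l)),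
    (enc (lDM DM (restrict_left A O), Nil task)); split.
    by rewrite enc_inputE; apply: ExecSeq runk (st _ _ stop).
  rewrite !outputs_cat !outputs_ticks cats0 out.
  have [_ _ O_gt0 _] := instO.
  by rewrite /enumerate /ComputeAllSolutions; case: (O) O_gt0.
(* s bounds the sizes of the input and of the first state of the loop, m those of
   all states of the loop. *)
pose (s := fun y : instance => N y + q0.[N y]%R).
pose (m := fun y : instance => s y + (s y * s y + s y + s y + 6) * (s y * s y + 1) + 3).
pose (T := fun y : instance => (step_time q1).[m y]%R).
(* [s] pays for reading the input and computing the first state. At most [size O + 2] steps of time
   [T] pass between two outputs, and [size O] is below [s]. *)
have [p le_p] : pbounded (fun y => s y + T y * (s y + 3)).
  have b1 (n : nat) : pbounded (fun _ : instance => n) by exact: pbounded_const.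
  have bs : pbounded s by apply: pboundedD bN (pbounded_horner _ bN).
  have bss : pbounded (fun y => s y * s y) by exact: (pboundedM bs bs).
  have bm : pbounded m.
    apply: (pboundedD _ (b1 3)); apply: (pboundedD bs).
    apply: pboundedM (pboundedD bss (b1 1)).
    exact: pboundedD (pboundedD (pboundedD bss bs) bs) (b1 6).
  exact: pboundedD bs (pboundedM (pbounded_horner _ bm) (pboundedD bs (b1 3))).
exists p => A O leftA connA uniqO O_gt0 subO tpA B c instAB colc.
set A1 := restrict_left A O; set AV := lDM DM A1.
set BV := rDM DM A1 (restrict_right A B O c).
pose (x := (((A, B), O), c)); pose y := x.1.
have adm : admissible x by [].
have [k le_k runk] := run0 x adm.
have {}le_k : k <= q0.[N y]%R.
  by apply: leq_trans le_k (leq_trans (bt0 _) (leq_horner _ _)); apply: le_N.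
have le_start : esize (start DM x) <= q0.[N y]%R.
  apply: leq_trans (computes_size (run0 x adm)) _.
  by apply: leq_trans (bt0 _) (leq_horner _ (le_N _ adm)).
have le_input : dsize (input A B O c) <= N y by rewrite enc_inputE; apply: (le_N x adm).
have le_s : esize AV + esize O + esize BV + 5 <= s y.
  move: le_start; rewrite /start /= !esize_pair esize_cons !esize_pair !esize_nil.
  by rewrite -/A1 -/AV -/BV /s; lia.
have {le_p}le_p : s y + T y * (s y + 3) <= p.[dsize (of_ecsp A B O)]%R.
  by rewrite enc_ecspE; apply: le_p.
have [l le_l stop] := loop_stop P1 q1 AV.
have {}le_l : l <= T y.
  apply: leq_trans le_l (leq_horner _ _).
  by rewrite esize_pair esize_nil /m; move: le_s; lia.
have start_exec tr : steps P1 AV [:: (O, (BV, [::]))] tr [::] ->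
    exec (pSeq P0 (loop P1)) (input A B O c)
      (ticks (dsize (input A B O c)) ++ ticks k ++ (tr ++ ticks l)) (enc (AV, Nil task)).
  by move=> st; rewrite enc_inputE; apply: ExecSeq runk (st _ _ stop).
have size_O : size O < esize O by exact: size_esize.
have gt0_BV : 0 < esize BV by exact: esize_gt0.
have mem_sol := mem_Propagate instAB uniqO O_gt0 subO colc connA tpA.
have uniq_sol := uniq_Propagate instAB uniqO O_gt0 subO colc connA tpA.
have [[h homh]|inactive] := hom_or_inactive instAB uniqO O_gt0 subO colc connA tpA.
  have sol : exists s0, solution A B O s0.
    by exists (map h O); exists h => //; apply/(hom_restrict colc).
  have tameO := tame_root instAB uniqO O_gt0 subO colc connA tpA sol.
  have [tr [st out pace]] := steps_task run1 AV O BV [::] [::].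
  exists (ticks (dsize (input A B O c)) ++ ticks k ++ (tr ++ ticks l)), (enc (AV, Nil task)).
  split; first exact: start_exec.
  exists (Propagate AV O BV [::]); split => //.
  - by rewrite !outputs_cat !outputs_ticks cats0 out Propagate_enumerate.
  - by case: sol => s0 sol0 /(_ s0).
  have {}pace : paced (s y + T y * (s y + 3)) (T y) (T y * (size O).+1) tr.
    apply: (pace _ _ _ _ tameO); last first.
      apply: leq_trans (leq_addl _ _); rewrite leq_mul2l; apply/orP; right.
      by move: le_s size_O; lia.
    rewrite esize_nil /m -/A1 -/BV.
    (* The two factors in [m] bound the size of a task and the number of tasks on the stack. *)
    have le_W : (esize O * esize BV + esize O + esize BV + 5).+1 <=
        s y * s y + s y + s y + 6.
      have : esize O * esize BV <= s y * s y by apply: leq_mul; move: le_s; lia.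
      by move: le_s; lia.
    have le_D : (size O * esize BV).+1 <= s y * s y + 1.
      by rewrite addn1 ltnS; apply: leq_mul; move: le_s size_O; lia.
    by have := leq_mul le_W le_D; move: le_s; lia.
  move=> tr1 j v tr2 eq_tr; apply: leq_trans le_p; apply: (paced_delay _ _ eq_tr); last first.
    by apply: paced_ticksl; apply: paced_ticksl; apply: paced_ticksr pace.
  have : T y * (size O).+1 <= T y * (s y + 3).
    by rewrite leq_mul2l; apply/orP; right; move: le_s size_O; lia.
  by move: le_input le_k; rewrite {2}/s; lia.
(* With no active value for the first variable, one expansion empties the stack and the loop
   stops. *)
have OE : O = head Leaf O :: behead O by case: (O) O_gt0.
have [j le_j] := steps_expand run1 AV (head Leaf O) (behead O) BV [::] [::].
rewrite -OE /subtasks inactive => st.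
have {}le_j : j <= T y.
  apply: leq_trans le_j (leq_horner _ _).
  rewrite -OE; apply: leq_trans le_start _; rewrite /m /s; lia.
have no_out : outputs (ticks (dsize (input A B O c)) ++ ticks k ++ (ticks j ++ ticks l)) = [::].
  by rewrite !outputs_cat !outputs_ticks.
exists (ticks (dsize (input A B O c)) ++ ticks k ++ (ticks j ++ ticks l)), (enc (AV, Nil task)).
split; first exact: start_exec.
exists (Propagate AV O BV [::]); split => //.
- rewrite no_out (_ : Propagate AV O BV [::] = [::]) //.
  move: inactive; rewrite Propagate_enumerate // -/A1 -/AV -/BV.
  by case: (O) O_gt0 => // X O' _; rewrite enumerate_cons => /= ->.
- move=> _; apply: leq_trans le_p; rewrite !size_cat !size_nseq.
  by move: le_input le_k le_j le_l; rewrite {1}/s; nia.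
move=> tr1 i v tr2 eq_tr; move: no_out; rewrite eq_tr !outputs_cat /=.
by case: (outputs tr1) => //=; case: (outputs (ticks i)).
Qed.
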